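(* Let $\mathbb X$ and $\mathbb Y$ be minimal, aperiodic flow spaces with expansions $(X_i,f_i,p_i)$ of $\mathbb X$ and $(X_i,g_i,q_i)$ of $\mathbb Y$ using the same oriented wedges $X_i$ (with wedge points $x_i$). Suppose that for every $i$ there is $a_i\in\pi_1(X_i,x_i)$ with $\pi_1(g_i)=\mathbf c_{a_i}\pi_1(f_i)$. Then $\mathbb X$ and $\mathbb Y$ are flow equivalent.
   Context: Flow space: compact metrizable space of topological dimension one with continuous $\mathbb R$-action without fixed points; minimal: all orbits dense; aperiodic: no periodic orbit; flow equivalence: homeomorphism mapping orbits to orbits preserving flow orientation. Expansion of $\mathbb X$ about a point $x_\bullet$: oriented wedges of circles $X_i$ with wedge points $x_i$, positive maps $f_i\colon X_{i+1}\to X_i$ (continuous surjections, wedge point to wedge point, orientation preserving on each circle, locally injective away from the wedge point), projections $p_i\colon\mathbb X\to X_i$ (continuous surjections, locally injective and orientation preserving along orbits) with $p_i(x_\bullet)=x_i$, $p_n=f_n\circ\cdots\circ f_{m-1}\circ p_m$, and $x\mapsto(p_i(x))_i$ a homeomorphism onto $\varprojlim(X_i,f_i)$. $\pi_1(f_i)\colon\pi_1(X_{i+1},x_{i+1})\to\pi_1(X_i,x_i)$ is the induced homomorphism, and $\mathbf c_ah(x)=a^{-1}h(x)a$. *)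

(* Defs.v *)
From HB Require Import structures.
From mathcomp Require Import all_boot all_order all_algebra.
From mathcomp Require Import all_classical all_reals all_analysis.
Import Order.TTheory GRing.Theory Num.Theory.
Import numFieldNormedType.Exports.
Set Implicit Arguments. Unset Strict Implicit. Unset Printing Implicit Defensive.
Local Open Scope classical_set_scope.
Local Open Scope ring_scope.

Section FlowDefs.
Variable R : realType.

Definition metrizable (X : topologicalType) : Prop :=
  exists d : X -> X -> R,
    (forall x y, d x y = 0 <-> x = y) /\
    (forall x y, d x y = d y x) /\
    (forall x y z, d x z <= d x y + d y z) /\
    (forall x, nbhs x = filter_from [set e : R | 0 < e] (fun e => [set y | d x y < e])).

Definition covdim_le (n : nat) (X : topologicalType) : Prop :=
  forall (k : nat) (U : 'I_k -> set X),
    (forall i, open (U i)) -> (forall x, exists i, U i x) ->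
    exists (l : nat) (V : 'I_l -> set X),
      (forall j, open (V j)) /\ (forall x, exists j, V j x) /\
      (forall j, exists i, V j `<=` U i) /\
      (forall x, (#|[pred j : 'I_l | `[< V j x >] ]| <= n.+1)%N).

Definition topdim_one (X : topologicalType) : Prop :=
  covdim_le 1 X /\ ~ covdim_le 0 X.

Definition is_flow (X : topologicalType) (phi : R -> X -> X) : Prop :=
  continuous (fun q : R * X => phi q.1 q.2) /\
  (forall x, phi 0 x = x) /\
  (forall s t x, phi (s + t) x = phi s (phi t x)).

Definition flow_space (X : topologicalType) (phi : R -> X -> X) : Prop :=
  compact [set: X] /\ metrizable X /\ topdim_one X /\ is_flow phi /\
  (forall x, exists t, phi t x <> x).

Definition minimal_flow (X : topologicalType) (phi : R -> X -> X) : Prop :=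
  forall x, closure (range (fun t => phi t x)) = [set: X].

Definition aperiodic_flow (X : topologicalType) (phi : R -> X -> X) : Prop :=
  ~ exists x t, t <> 0 /\ phi t x = x.

Definition flow_equivalent (X Y : topologicalType) (phi : R -> X -> X)
    (psi : R -> Y -> Y) : Prop :=
  exists (h : X -> Y) (h' : Y -> X),
    cancel h h' /\ cancel h' h /\ continuous h /\ continuous h' /\
    forall x, exists tau : R -> R,
      bijective tau /\ (forall s t, s < t -> tau s < tau t) /\
      forall t, h (phi t x) = psi (tau t) (h x).

(* Model: circle k (k < n) has centre (k+1, 0) and radius k+1; all circles
   pass through the origin (the wedge point) and meet only there.
   circle_pt k t parametrises circle k, 1-periodic in t, positively oriented,
   with circle_pt k 0 = wedge point. *)
Definition circle_pt (k : nat) (t : R) : R * R :=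
  (k.+1%:R - k.+1%:R * cos (2 * pi * t), - (k.+1%:R * sin (2 * pi * t))).

Definition wedge_pt : R * R := (0, 0).

Definition wedge (n : nat) : set (R * R) :=
  [set z | exists k t, (k < n)%N /\ z = circle_pt k t].

(* gamma : R -> wedge n is locally injective and orientation preserving at t0:
   near t0 it moves positively along circle k' (before t0) and circle k
   (after t0), in a strictly increasing continuous angle coordinate. *)
Definition positive_at (n : nat) (gamma : R -> R * R) (t0 : R) : Prop :=
  exists (k k' : nat) (d : R) (lam : R -> R),
    [/\ (k < n)%N, (k' < n)%N & 0 < d] /\
    (forall s t, t0 - d < s -> s < t -> t < t0 + d -> lam s < lam t) /\
    {within `](t0 - d), (t0 + d)[, continuous lam} /\
    (forall t, t0 <= t -> t < t0 + d -> gamma t = circle_pt k (lam t)) /\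
    (forall t, t0 - d < t -> t <= t0 -> gamma t = circle_pt k' (lam t)).

Definition positive_curve (n : nat) (gamma : R -> R * R) : Prop :=
  forall t0, positive_at n gamma t0.

Definition positive_map (m n : nat) (f : R * R -> R * R) : Prop :=
  [/\ {within wedge m, continuous f}, f @` wedge m = wedge n,
      f wedge_pt = wedge_pt &
      forall k, (k < m)%N -> positive_curve n (f \o circle_pt k)].

Definition projection (X : topologicalType) (phi : R -> X -> X) (n : nat)
    (p : X -> R * R) : Prop :=
  [/\ continuous p, range p = wedge n &
      forall x, positive_curve n (fun t => p (phi t x))].

Fixpoint fcomp (f : nat -> R * R -> R * R) (n d : nat) : R * R -> R * R :=
  match d with
  | 0 => id
  | d'.+1 => fcomp f n d' \o f (n + d')%N
  end.

Definition invlim (N : nat -> nat) (f : nat -> R * R -> R * R) :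
    set {ptws nat -> (R * R)%type} :=
  [set z | forall i, wedge (N i) (z i) /\ f i (z i.+1) = z i].

Definition thread (X : topologicalType) (p : nat -> X -> R * R) :
    X -> {ptws nat -> (R * R)%type} := fun x i => p i x.

Definition expansion (X : topologicalType) (phi : R -> X -> X) (xb : X)
    (N : nat -> nat) (f : nat -> R * R -> R * R) (p : nat -> X -> R * R) :
    Prop :=
  [/\ forall i, positive_map (N i.+1) (N i) (f i),
      forall i, projection phi (N i) (p i),
      forall i, p i xb = wedge_pt,
      forall n m, (n <= m)%N -> forall x, p n x = fcomp f n (m - n) (p m x) &
      [/\ continuous (thread p), injective (thread p),
          range (thread p) = invlim N f &
          forall U : set X, open U ->
            exists V : set {ptws nat -> (R * R)%type},
              open V /\ thread p @` U = V `&` range (thread p)]].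

Definition loop (n : nat) (g : R -> R * R) : Prop :=
  [/\ {within `[0, 1], continuous g},
      forall t, 0 <= t -> t <= 1 -> wedge n (g t),
      g 0 = wedge_pt & g 1 = wedge_pt].

Definition unit_square : set (R * R) :=
  [set q | 0 <= q.1 <= 1 /\ 0 <= q.2 <= 1].

Definition loop_homotopic (n : nat) (g1 g2 : R -> R * R) : Prop :=
  exists H : R * R -> R * R,
    [/\ {within unit_square, continuous H},
        forall q, unit_square q -> wedge n (H q),
        forall s, 0 <= s -> s <= 1 -> H (0, s) = g1 s /\ H (1, s) = g2 s &
        forall u, 0 <= u -> u <= 1 -> H (u, 0) = wedge_pt /\ H (u, 1) = wedge_pt].

Definition pcat (g1 g2 : R -> R * R) (t : R) : R * R :=
  if t <= 2^-1 then g1 (2 * t) else g2 (2 * t - 1).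

Definition path_rev (g : R -> R * R) (t : R) : R * R := g (1 - t).

End FlowDefs.

(* Main.v *)
(* Both maps [f i] and [g i] send each circle to a positive word, and conjugate
   positive words in a free group are cyclic shifts of each other, by a shift
   that only depends on the conjugating element [a i]. Hence for every
   bi-infinite path in [X_(i+1)] the images under [f i] and [g i] are the same
   path in [X_i] up to a shift of bounded length, so that [g i (p (i+1) x)] is
   [p i] of the point reached by moving [x] along its orbit for a suitable
   time, continuous in [x]. Starting from time 0 at level 0 and undoing these
   shifts one level after the other gives times [sh i x] such that the points
   [p i (phi (sh i x) x)] form a thread of [(X_i, g i)], that is a point [h x]
   of [Y]. The map [h] sends orbits to orbits because point inverses of the
   bonding maps are finite: sliding [h (phi t x)] back to the phase at level 0
   of [h x] gives a path in [Y] with finitely many values at each level. *)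
Require Import Defs.
From HB Require Import structures.
From mathcomp Require Import all_boot all_order all_algebra.
From mathcomp Require Import all_classical all_reals all_analysis.
From mathcomp Require Import zify ring lra.
Set Implicit Arguments. Unset Strict Implicit. Unset Printing Implicit Defensive.
Import Order.TTheory GRing.Theory Num.Theory.
Import numFieldNormedType.Exports.

(** * Positive words in free groups *)

(** The fundamental group is never built as a group. A loop is sampled on a fine grid and becomes a
    word that records its passages through the antipodes of the wedge point, so that homotopy
    invariance reduces to a cocycle identity for nearby points. A conjugating word may a priori mix
    letters and inverse letters; comparing positive words more than twice as long as it forces it to
    have one sign. Hence long blocks of a bi-infinite path are compared, not the images of single
    circles, and the resulting shift is the exponent sum of the conjugating word, the same for every
    block. The phase along an orbit is determined only up to an integer, so all times are found by
    solving equations between phase increments, which are continuous in the point and strictly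
    increasing in time. Injectivity of [h] needs its own induction over the levels, along two orbits
    with the same image; surjectivity comes from minimality of the target flow. *)

Notation letter := (nat * bool)%type.
Definition linv (l : letter) : letter := (l.1, ~~ l.2).
Lemma linvK : involutive linv. Proof. by case=> k b; rewrite /linv /= negbK. Qed.

(** Left multiplication by a letter with at most one cancellation. This is van der Waerden's trick:
    by [reduced_act] and [actK] the free group acts on reduced words, and normal forms are read off
    from the action on the empty word. *)
Definition act (l : letter) (w : seq letter) : seq letter :=
  if w is l' :: w' then if l' == linv l then w' else l :: w else [:: l].
Definition actw (u w : seq letter) : seq letter := foldr act w u.

Fixpoint reduced (w : seq letter) : bool :=
  if w is l :: w' then
    (if w' is l' :: _ then l' != linv l else true) && reduced w'
  else true.

Lemma reduced_act l w : reduced w -> reduced (act l w).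
Proof.
case: w => [|l' w] //= /andP[h rw].
case: (boolP (l' == linv l)) => [_ //|ne] /=.
by rewrite ne h rw.
Qed.

Lemma reduced_actw u w : reduced w -> reduced (actw u w).
Proof. by elim: u => //= l u IH rw; apply: reduced_act; apply: IH. Qed.

Lemma actK l w : reduced w -> act l (act (linv l) w) = w.
Proof.
case: w => [|l' w] /=; first by rewrite eqxx.
rewrite linvK => /andP[h rw].
case: eqP h => [-> h|ne _] /=; last by rewrite eqxx.
by case: w h {rw} => [|l2 w] //= /negbTE ->.
Qed.

(* The free group, as words modulo having the same action on reduced words. *)
Definition weq (u v : seq letter) : Prop :=
  forall w, reduced w -> actw u w = actw v w.

Lemma actw_cat u v w : actw (u ++ v) w = actw u (actw v w).
Proof. by rewrite /actw foldr_cat. Qed.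

Lemma weq_refl u : weq u u. Proof. by []. Qed.
Lemma weq_sym u v : weq u v -> weq v u.
Proof. by move=> e w rw; rewrite e. Qed.
Lemma weq_trans v u w : weq u v -> weq v w -> weq u w.
Proof. by move=> e1 e2 x rx; rewrite e1 // e2. Qed.
Lemma weq_cat u u' v v' : weq u u' -> weq v v' -> weq (u ++ v) (u' ++ v').
Proof.
by move=> e1 e2 x rx; rewrite !actw_cat e2 // e1 //; apply: reduced_actw.
Qed.
Lemma weq_linvr l : weq [:: l; linv l] [::].
Proof. by move=> w rw; rewrite /= actK. Qed.

Definition winv (u : seq letter) : seq letter := rev (map linv u).

Lemma actw_nil_reduced r : reduced r -> actw r [::] = r.
Proof.
elim: r => //= l r IH /andP[h rr]; rewrite IH //.
by case: r h {IH rr} => //= l' r; case: eqP.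
Qed.

Lemma weq_actw_nil u : weq (actw u [::]) u.
Proof.
elim: u => // l u IH /=.
have rr : reduced (actw u [::]) by apply: reduced_actw.
apply: (@weq_trans (l :: actw u [::])).
  case: (actw u [::]) => //= l' r.
  case: eqP => // -> w rw /=.
  by rewrite actK //; apply: reduced_actw.
by move=> w rw /=; rewrite IH.
Qed.

(** * Positive words and conjugacy between them *)

Definition pos (v : seq nat) : seq letter := [seq (k, true) | k <- v].

Lemma reduced_pos v : reduced (pos v).
Proof. by elim: v => // k [|k' v] //= ->; rewrite andbT; apply/eqP => -[]. Qed.

Lemma pos_inj : injective pos.
Proof. by apply: inj_map => x y [->]. Qed.

Lemma pos_cat v w : pos (v ++ w) = pos v ++ pos w.
Proof. exact: map_cat. Qed.

(** Neither factor cancels internally, so cancellation starts at the junction and consumes a suffix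
    of [r] against a prefix [s] of [w]. *)
Lemma actw_pos_decomp r w : reduced r ->
  exists r1 s w', [/\ r = r1 ++ winv (pos s), w = s ++ w' &
    actw r (pos w) = r1 ++ pos w'].
Proof.
elim: r => [|l r IH] /=; first by exists [::], [::], w.
case/andP=> hl /IH[r1 [s [w' [er ew ->]]]].
case: r1 er => [|l1 r1] er /=; last first.
  exists (l :: l1 :: r1), s, w'; split=> //; first by rewrite er.
  by move: hl; rewrite er /= => /negbTE ->.
case: w' ew => [|k w'] ew /=; first by exists [:: l], s, [::]; rewrite er.
case: eqP => [e|_]; last by exists [:: l], s, (k :: w'); rewrite er.
exists [::], (rcons s k), w'; split=> //; last by rewrite cat_rcons.
have -> : l = (k, false) by rewrite -(linvK l) -e.
by rewrite er /winv /pos map_rcons map_rcons rev_rcons.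
Qed.

Lemma actw_pos_decompl v r :
  exists v' t r2, [/\ v = v' ++ t, r = winv (pos t) ++ r2 &
    actw (pos v) r = pos v' ++ r2].
Proof.
elim: v => [|k v [v' [t [r2 [ev er e0]]]]]; first by exists [::], [::], r.
rewrite -[actw _ r]/(act (k, true) (actw (pos v) r)) e0 {e0}.
case: v' ev => [|k' v'] ev /=; last first.
  exists (k :: k' :: v'), t, r2; split=> //; first by rewrite ev.
  by case: eqP => // -[].
case: r2 er => [|l r2] er /=; first by exists [:: k], t, [::]; rewrite ev.
case: eqP => [e|_]; last by exists [:: k], t, (l :: r2); rewrite ev.
exists [::], (k :: v), r2; split=> //.
move: ev => /= ev; by rewrite er e ev /winv /pos /= rev_cons cat_rcons.
Qed.

(** The homomorphism to the integers sending every generator to 1. It gives the length of positive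
    words and, later on, the shift caused by conjugation. *)
Definition expsum (w : seq letter) : int :=
  (\sum_(l <- w) (if l.2 then 1 else -1))%R.

Lemma expsum_act l w : (expsum (act l w) = expsum [:: l] + expsum w)%R.
Proof.
rewrite /expsum; case: w => [|l' w] /=; first by rewrite big_nil addr0.
case: eqP => [->|_]; rewrite ?big_cons ?big_nil //=; last by lia.
by case: l.2 => /=; lia.
Qed.

Lemma expsum_cons l w : (expsum (l :: w) = expsum [:: l] + expsum w)%R.
Proof. by rewrite /expsum !big_cons big_nil addr0. Qed.

Lemma expsum_actw u w : (expsum (actw u w) = expsum u + expsum w)%R.
Proof.
elim: u => [|l u IH] /=; first by rewrite /expsum big_nil add0r.
by rewrite expsum_act IH (expsum_cons l u) addrA.
Qed.

Lemma expsum_pos v : expsum (pos v) = (size v)%:Z%R.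
Proof.
elim: v => [|k v IH]; first by rewrite /expsum big_nil.
by rewrite /= expsum_cons IH /expsum big_cons big_nil /=; lia.
Qed.

Lemma expsum_winv v : expsum (winv (pos v)) = (- (size v)%:Z)%R.
Proof.
rewrite /expsum big_rev /= /pos !big_map /=.
elim: v => [|k v IH]; rewrite ?big_nil ?big_cons //= IH; lia.
Qed.

Lemma weq_size r v w : weq (pos v ++ r) (r ++ pos w) -> size v = size w.
Proof.
move/(_ [::] isT) => e; have := congr1 expsum e.
rewrite !actw_cat !expsum_actw !expsum_pos; lia.
Qed.

Lemma all_pos v : all (fun l : letter => l.2) (pos v).
Proof. by elim: v. Qed.
Lemma all_neg v : all (fun l : letter => ~~ l.2) (winv (pos v)).
Proof. by rewrite all_rev; elim: v. Qed.

Lemma pos_of_all r : all (fun l : letter => l.2) r -> exists a, r = pos a.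
Proof.
elim: r => [|[k b] r IH] /=; first by exists [::].
by case/andP=> -> /IH[a ->]; exists (k :: a).
Qed.

(** Compare the normal forms of the two sides. The bound on [size r] leaves on the left a positive
    prefix at least as long as [r1], so [r1] is positive, and then so is [r2]. Thus [r] is both a
    positive word followed by a negative one and a negative word followed by a positive one, hence
    it has only one sign. *)
Lemma weq_conj_pos r v w : weq (pos v ++ r) (r ++ pos w) ->
  reduced r -> (2 * size r < size v)%N ->
  (exists2 a, r = pos a & v ++ a = a ++ w) \/
  (exists2 s, r = winv (pos s) & s ++ v = w ++ s).
Proof.
move=> e rr lt_r; have esz := weq_size e.
have {e} : actw (pos v) r = actw r (pos w).
  have := e [::] isT; rewrite !actw_cat (actw_nil_reduced rr).
  by rewrite (actw_nil_reduced (reduced_pos w)).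
have [r1 [s [w' [er1 ew ->]]]] := @actw_pos_decomp r w rr.
have [v' [t [r2 [ev er2 ->]]]] := actw_pos_decompl v r.
have sz1 : size r = size r1 + size s.
  by rewrite er1 size_cat /winv size_rev !size_map.
have sz2 : size r = size t + size r2.
  by rewrite er2 size_cat /winv size_rev !size_map.
have szv : size v = size v' + size t by rewrite ev size_cat.
have szw : size w = size s + size w' by rewrite ew size_cat.
move=> e.
have [a ea] : exists a, r1 = pos a.
  apply: pos_of_all.
  have -> : r1 = take (size r1) (pos v').
    have -> : take (size r1) (pos v') = take (size r1) (pos v' ++ r2).
      by rewrite takel_cat // size_map; lia.
    by rewrite e take_size_cat.
  by apply/allP => l /mem_take; apply/allP/all_pos.
have [b eb] : exists b, r2 = pos b.
  apply: pos_of_all.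
  have -> : r2 = drop (size v') (r1 ++ pos w') by rewrite -e drop_size_cat // size_map.
  rewrite ea drop_cat size_map; case: ifP => _.
    rewrite all_cat all_pos andbT; apply/allP => l /mem_drop.
    by apply/allP/all_pos.
  by apply/allP => l /mem_drop; apply/allP/all_pos.
case: s er1 ew sz1 szw => [|k s] er1 ew sz1 szw.
- left; exists a; first by rewrite er1 ea /winv /= cats0.
  have et : t = [::].
    case: t er2 {ev sz2 szv} => // k t; rewrite er1 ea /winv /= cats0 => h.
    have := all_pos a; rewrite h all_cat => /andP[].
    by rewrite rev_cons all_rcons.
  move: er2 ev; rewrite et /winv /= cats0 => er2 ev.
  have ab : a = b by apply: pos_inj; rewrite -eb -er2 er1 ea /winv /= cats0.
  apply: pos_inj; rewrite ew ev !pos_cat /=.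
  by rewrite {1}ab -eb -ea e.
- have eb0 : b = [::].
    case: (lastP b) eb => [//|b' k']; move=> eb.
    have : last (0, true) r = (k', true).
      by rewrite er2 eb /pos map_rcons last_cat last_rcons.
    rewrite er1 /winv /pos /= rev_cons last_cat.
    by rewrite last_rcons /linv /=; case.
  have rn : r = winv (pos t) by rewrite er2 eb eb0 cats0.
  have a0 : a = [::].
    case: a ea => // k' a ea; have := all_neg t.
    by rewrite -rn er1 ea.
  have st : k :: s = t.
    have : winv (pos (k :: s)) = winv (pos t) by rewrite -rn er1 ea a0.
    move/(congr1 rev); rewrite /winv !revK.
    move/(inj_map (can_inj linvK)); exact: pos_inj.
  right; exists t => //; rewrite ev ew st.
  move: e; rewrite ea a0 eb eb0 cats0 /= => /pos_inj ->.
  by rewrite catA.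
Qed.

Local Open Scope classical_set_scope.
Local Open Scope ring_scope.

(** * Circles and wedges *)

Lemma continuous_pair (T U V : topologicalType) (f : T -> U) (g : T -> V) :
  continuous f -> continuous g -> continuous (fun x => (f x, g x)).
Proof. move=> cf cg x; exact: (cvg_pair (cf x) (cg x)). Qed.

Section Circles.
Variable R : realType.
Implicit Types (s t u : R) (k n : nat) (m : int).

Lemma cos_2piDz s m : cos (2 * pi * (s + m%:~R)) = cos (2 * pi * s).
Proof.
have Q j t : cos (2 * pi * (t + j%:R)) = cos (2 * pi * t).
  by rewrite -[RHS](periodicn (@cosD2pi R) j) mulrDr -[pi *+ 2]mulr_natl mulr_natr.
case: m => j; first exact: Q.
by rewrite NegzE mulrNz -(Q j.+1) subrK.
Qed.

Lemma sin_2piDz s m : sin (2 * pi * (s + m%:~R)) = sin (2 * pi * s).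
Proof.
have Q j t : sin (2 * pi * (t + j%:R)) = sin (2 * pi * t).
  by rewrite -[RHS](periodicn (@sinD2pi R) j) mulrDr -[pi *+ 2]mulr_natl mulr_natr.
case: m => j; first exact: Q.
by rewrite NegzE mulrNz -(Q j.+1) subrK.
Qed.

Lemma circle_ptDz k s m : circle_pt k (s + m%:~R) = circle_pt k s.
Proof. by rewrite /circle_pt cos_2piDz sin_2piDz. Qed.

Lemma circle_pt0 k : circle_pt k 0 = wedge_pt R.
Proof. by rewrite /circle_pt mulr0 cos0 sin0 !mulr0 mulr1 subrr oppr0. Qed.

Lemma circle_ptz k m : circle_pt k m%:~R = wedge_pt R.
Proof. by rewrite -[m%:~R]add0r circle_ptDz circle_pt0. Qed.

Lemma sin_2pi_gt0 s : 0 < s -> s < 2^-1 -> 0 < sin (2 * pi * s).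
Proof.
move=> s0 s1; apply: sin_gt0_pi; have := pi_gt0 R => p0; apply/andP; split.
  by rewrite !mulr_gt0.
nra.
Qed.

Lemma sin_2pi_le0 s : 2^-1 <= s -> s <= 1 -> sin (2 * pi * s) <= 0.
Proof.
move=> s0 s1; rewrite -(sin_2piDz s (-1)) -oppr_ge0 -sinN; apply: sin_ge0_pi.
have := pi_gt0 R => p0; rewrite mulrNz mulr1z; apply/andP; split; nra.
Qed.

Lemma cos_2pi_gt0 s : - 4^-1 < s -> s < 4^-1 -> 0 < cos (2 * pi * s).
Proof.
move=> s0 s1; apply: cos_gt0_pihalf; have := pi_gt0 R => p0.
apply/andP; split; nra.
Qed.

Lemma cos_2pi_lt0 s : 4^-1 < s -> s < 3 / 4 -> cos (2 * pi * s) < 0.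
Proof.
move=> s0 s1; rewrite -oppr_gt0.
have -> : cos (2 * pi * s) = - cos (2 * pi * (s - 2^-1)).
  by rewrite -cosDpi; congr cos; field.
by rewrite opprK; apply: cos_2pi_gt0; lra.
Qed.

Lemma cos_2pi_eq1 s : cos (2 * pi * s) = 1 -> exists m, s = m%:~R.
Proof.
move=> h; exists (Num.floor s).
set r := s - (Num.floor s)%:~R; suff : r = 0 by move/subr0_eq.
have hr : 0 <= r < 1 by have := floor_itv s; rewrite /r intrD mulr1z; lra.
have {}h : cos (2 * pi * r) = 1 by rewrite /r -mulrNz cos_2piDz.
have := pi_gt0 R => p0.
apply/eqP/negP => /negP r0; have : 0 < sin (pi * r).
  apply: sin_gt0_pi; apply/andP; split; last by nra.
  by rewrite mulr_gt0 // lt0r r0; case/andP: hr.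
have : cos (2 * pi * r) = 1 - sin (pi * r) ^+ 2 *+ 2.
  have -> : 2 * pi * r = (pi * r) *+ 2 by ring.
  by rewrite cos_mulr2n cos2sin2; ring.
by rewrite h; nra.
Qed.

(** The equation of circle [k]. Away from the wedge point it recovers [k], both in [circle_pt_inj]
    and in the formula for [kap]. *)
Lemma circle_pt_sq k s : (circle_pt k s).1 ^+ 2 + (circle_pt k s).2 ^+ 2 =
  2 * k.+1%:R * (circle_pt k s).1.
Proof.
rewrite /circle_pt /=.
set K := k.+1%:R; set C := cos _; set S := sin _.
have e : C ^+ 2 + S ^+ 2 = 1 by exact: cos2Dsin2.
by transitivity (K ^+ 2 * (C ^+ 2 + S ^+ 2 + 1 - 2 * C)); [ring|rewrite e; ring].
Qed.

Lemma circle_pt_x0 k s : (circle_pt k s).1 = 0 -> exists m, s = m%:~R.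
Proof.
move=> h; apply: cos_2pi_eq1; move: h; rewrite /circle_pt /=.
move/eqP; rewrite subr_eq0 => /eqP h.
have k0 : k.+1%:R != 0 :> R by [].
by apply: (mulfI k0); rewrite -h mulr1.
Qed.

Lemma circle_pt_wedge k s : circle_pt k s = wedge_pt R -> exists m, s = m%:~R.
Proof. by move=> h; apply: (@circle_pt_x0 k); rewrite h. Qed.

Lemma circle_pt_inj k k' s t : circle_pt k s = circle_pt k' t ->
  circle_pt k s <> wedge_pt R -> k = k'.
Proof.
move=> h hn.
have x0 : (circle_pt k s).1 != 0.
  by apply/eqP => /circle_pt_x0[m sm]; apply: hn; rewrite sm circle_ptz.
have := circle_pt_sq k s; rewrite h circle_pt_sq -h => /(mulIf x0).
have t0 : 2 != 0 :> R by [].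
by move/(mulfI t0)/eqP; rewrite eqr_nat eqSS => /eqP.
Qed.

(** All circles share one phase modulo 1, since at the wedge point every phase is an integer. This
    is why two lifts of a curve differ by an integer. *)
Lemma circle_pt_phase k k' s t : circle_pt k s = circle_pt k' t ->
  exists m, t = s + m%:~R.
Proof.
move=> h; have [hw|/eqP hw] := eqVneq (circle_pt k s) (wedge_pt R).
  have [m ->] := circle_pt_wedge hw.
  have [m' ->] : exists m, t = m%:~R by apply: (@circle_pt_wedge k'); rewrite -h.
  by exists (m' - m); rewrite intrB addrC subrK.
have ek := circle_pt_inj h hw; move: h; rewrite -ek /circle_pt => -[hc hs].
have k0 : k.+1%:R != 0 :> R by [].
have ec : cos (2 * pi * t) = cos (2 * pi * s).
  apply: (mulfI k0); lra.
have es : sin (2 * pi * t) = sin (2 * pi * s).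
  apply: (mulfI k0); lra.
have [m hm] : exists m, t - s = m%:~R.
  apply: cos_2pi_eq1; rewrite mulrBr cosB ec es.
  by have := cos2Dsin2 (2 * pi * s); nra.
by exists m; rewrite -hm addrC subrK.
Qed.

Lemma circle_pt_continuous k : continuous (@circle_pt R k).
Proof.
have c2 (h : R -> R) : continuous h -> continuous (fun t : R => h (2 * pi * t)).
  move=> ch t; apply: (@continuous_comp _ _ _ (fun t => 2 * pi * t) h); last exact: ch.
  by apply: cvgM; [exact: cvg_cst | exact: cvg_id].
apply: continuous_pair => s.
  apply: cvgB; first exact: cvg_cst.
  by apply: cvgM; [exact: cvg_cst | apply: c2; exact: continuous_cos].
apply: cvgN; apply: cvgM; first exact: cvg_cst.
apply: c2; exact: continuous_sin.
Qed.

(* cp w traverses circle [w j] during the time interval [j, j + 1]. *)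
Definition cp (w : int -> nat) s : R * R := circle_pt (w (Num.floor s)) s.

Lemma cpz w m : cp w m%:~R = wedge_pt R.
Proof. by rewrite /cp circle_ptz. Qed.

Lemma cpE w m s : m%:~R <= s -> s <= m%:~R + 1 -> cp w s = circle_pt (w m) s.
Proof.
move=> ms; rewrite le_eqVlt => /orP[/eqP ->|sm].
  have -> : m%:~R + 1 = (m + 1)%:~R :> R by rewrite intrD mulr1z.
  by rewrite cpz circle_ptz.
by rewrite /cp (@floor_def _ s m) // ms intrD mulr1z.
Qed.

Lemma cp_shift w m s : cp w (s + m%:~R) = cp (fun j => w (j + m)) s.
Proof. by rewrite /cp circle_ptDz floorDrz ?intrKfloor // intr_int. Qed.

Lemma cp_phase w w' s t : cp w s = cp w' t -> exists m, t = s + m%:~R.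
Proof. exact: circle_pt_phase. Qed.

End Circles.

(** * Lifts of positive curves *)

Section RealLine.
Variable R : realType.
Implicit Types (a b c s t : R) (f g : R -> R).

(* [leP] would also rewrite occurrences of [min] and [max]. *)
Lemma le_or_lt s t : s <= t \/ t < s.
Proof. by case: (leP s t); [left|right]. Qed.

Lemma IVT_le f a b v : continuous f -> a <= b -> f a <= v -> v <= f b ->
  exists c, [/\ a <= c, c <= b & f c = v].
Proof.
move=> cf ab fa fb; have := @IVT R f a b v ab (continuous_subspaceT cf).
case.
  by apply/andP; split; [rewrite ge_min fa|rewrite le_max fb orbT].
by move=> c; rewrite in_itv /= => /andP[ac cb] fc; exists c.
Qed.

Lemma IVT_any f a b v : continuous f -> f a <= v -> v <= f b -> exists c, f c = v.
Proof.
move=> cf fa fb; have [ab|/ltW ba] := leP a b.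
  by have [c [_ _ <-]] := IVT_le cf ab fa fb; exists c.
have cg : continuous (fun t => - f t) by move=> t; apply: cvgN; exact: cf.
have [||c [_ _ h]] := @IVT_le _ b a (- v) cg ba; rewrite ?lerN2 //.
by exists c; apply: oppr_inj.
Qed.

Lemma int_gap (m n : int) (v : R) : m%:~R < v -> v < m%:~R + 1 -> v <> n%:~R.
Proof.
move=> h1 h2 e; move: h1 h2; rewrite e -[1](mulr1z 1) -intrD !ltr_int; lia.
Qed.

Lemma continuous_int_valued_const f a b : continuous f -> a <= b ->
  (forall t, a <= t -> t <= b -> exists m : int, f t = m%:~R) -> f a = f b.
Proof.
move=> + ab; wlog lt : f / f a < f b => [H cf h|cf h].
  have [l|l|//] := ltgtP (f a) (f b); first exact: (H f).
  suff : - f a = - f b by move/oppr_inj.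
  apply: (H (fun t => - f t)); first by rewrite ltrN2.
    by move=> t; apply: cvgN; exact: cf.
  by move=> t ta tb; have [m ->] := h t ta tb; exists (- m); rewrite mulrNz.
have [m fa] := h a (lexx _) ab; have [n fb] := h b ab (lexx _).
have mn : m + 1 <= n by rewrite -ltzD1 ltrD2r -(ltr_int R) -fa -fb.
have mn' : m%:~R + 1 <= n%:~R :> R by rewrite -[1](mulr1z 1) -intrD ler_int.
have [||c [ac cb e]] := @IVT_le f a b (m%:~R + 2^-1) cf ab; try lra.
have [k] := h c ac cb; rewrite e.
by move/(@int_gap m k); case; lra.
Qed.

(** Cousin's lemma, by the supremum of the points reachable from [a]. It is the passage from local
    to global for lifts, for constancy and for continuity of increments. *)
Lemma cousin (P : R -> R -> Prop) :
  (forall a b c, a <= b -> b <= c -> P a b -> P b c -> P a c) ->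
  (forall t, exists2 d, 0 < d & (forall a, t - d < a -> a <= t -> P a t) /\
                                (forall b, t <= b -> b < t + d -> P t b)) ->
  forall a b, a <= b -> P a b.
Proof.
move=> Pcat Ploc a b ab.
pose S := [set x | a <= x /\ x <= b /\ P a x].
have Sa : S a.
  split=> //; split=> //; have [d d0 [h _]] := Ploc a; apply: h => //; lra.
have ubS : ubound S b by move=> x [_ []].
have hS : has_sup S by split; [exists a|exists b].
have as_ : a <= sup S by apply: ub_le_sup => //; exists b.
have sb : sup S <= b by apply: ge_sup => //; exists a.
have [d d0 [hl hr]] := Ploc (sup S).
have [x [ax [xb Px]] xs] := sup_adherent d0 hS.
have xS : x <= sup S by apply: ub_le_sup; [exists b|].
have Ps : P a (sup S) by apply: (Pcat a x) => //; exact: hl.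
have [->//|ne] := eqVneq b (sup S).
have lt : sup S < b by rewrite lt_neqAle eq_sym ne.
pose y := Num.min (sup S + d / 2) b.
have sy : sup S < y by rewrite lt_min lt andbT; lra.
have yd : y < sup S + d by rewrite gt_min; apply/orP; left; lra.
have Sy : S y.
  split; first lra.
  split; first by rewrite ge_min lexx orbT.
  apply: (Pcat a (sup S)) => //; first lra.
  by apply: hr => //; lra.
have : y <= sup S by apply: ub_le_sup; [exists b|].
by lra.
Qed.

Lemma cousin_const (T : Type) (F : R -> T) :
  (forall t, exists2 d, 0 < d & forall s, `|s - t| < d -> F s = F t) ->
  forall a b, F a = F b.
Proof.
move=> h a b; wlog ab : a b / a <= b => [H|].
  by have [ab|/ltW ba] := leP a b; [exact: H|rewrite (H b a)].
apply: (@cousin (fun a b => F a = F b)) ab => [????? -> //|t].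
have [d d0 hd] := h t; exists d => //; split=> s s1 s2; first apply: hd.
  by rewrite ltr_norml; lra.
by symmetry; apply: hd; rewrite ltr_norml; lra.
Qed.

Lemma continuous_minr a : continuous (fun t : R => Num.min t a).
Proof. by move=> t; apply: (@continuous_min R R id (cst a)); [exact: cvg_id|exact: cvg_cst]. Qed.
Lemma continuous_maxr a : continuous (fun t : R => Num.max t a).
Proof. by move=> t; apply: (@continuous_max R R id (cst a)); [exact: cvg_id|exact: cvg_cst]. Qed.

Definition incr f := forall s t, s < t -> f s < f t.

Lemma incr_le f s t : incr f -> (f s <= f t) = (s <= t).
Proof.
move=> h; have [st|ts] := leP s t.
  by move: st; rewrite le_eqVlt => /orP[/eqP ->|/h/ltW]; rewrite ?lexx.
by apply/negP => ?; have := h _ _ ts; lra.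
Qed.

Lemma incr_lt f s t : incr f -> (f s < f t) = (s < t).
Proof. by move=> h; rewrite !ltNge incr_le. Qed.

Lemma incr_inj f : incr f -> injective f.
Proof.
by move=> h s t e; have [/h|/h|//] := ltgtP s t; rewrite e ltxx.
Qed.

Lemma open_near t (d : R) : 0 < d -> \forall s \near t, `|s - t| < d.
Proof.
move=> d0; near=> s; rewrite distrC; near: s.
by move/cvgrPdist_lt: (@cvg_id _ (nbhs t)); apply.
Unshelve. all: end_near. Qed.

Lemma nearR t (P : R -> Prop) : (\forall s \near t, P s) ->
  exists2 d, 0 < d & forall s, `|s - t| < d -> P s.
Proof.
case/nbhs_ballP => d /= d0 h; exists d => // s st; apply: h.
by rewrite /ball /= distrC.
Qed.

End RealLine.

(** * Lifting a curve to a phase and an itinerary *)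

Section Lines.
Variable R : realType.
Implicit Types (a b c s t : R) (gam : R -> R * R) (n : nat).

(** [lam] lifts the phase and [w] lists the circles visited. Only the values on [[a, b]] are
    constrained; continuity on the whole line avoids subspace topologies when pieces are glued. *)
Definition semiline n gam a b :=
  exists (lam : R -> R) (w : int -> nat), [/\ continuous lam,
    forall s t, a <= s -> s < t -> t <= b -> lam s < lam t,
    forall j, (w j < n)%N &
    forall t, a <= t -> t <= b -> gam t = cp w (lam t)].

Definition line n gam (lam : R -> R) (w : int -> nat) :=
  [/\ continuous lam, incr lam, forall j, (w j < n)%N &
    forall t, gam t = cp w (lam t)].

Lemma phase_unique (lam lam' : R -> R) (w w' : int -> nat) a b :
  continuous lam -> continuous lam' -> a <= b ->
  (forall t, a <= t -> t <= b -> cp w (lam t) = cp w' (lam' t)) ->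
  lam' a - lam a = lam' b - lam b.
Proof.
move=> cl cl' ab h.
apply: (@continuous_int_valued_const R (fun t => lam' t - lam t)) => //.
  by move=> t; apply: cvgB; [exact: cl'|exact: cl].
move=> t ta tb; have [m ->] := cp_phase (h t ta tb); exists m.
by rewrite addrC addKr.
Qed.

Lemma semiline_cat n gam a b c : a <= b -> b <= c ->
  semiline n gam a b -> semiline n gam b c -> semiline n gam a c.
Proof.
move=> ab bc [l1 [w1 [cl1 i1 n1 e1]]] [l2 [w2 [cl2 i2 n2 e2]]].
have eb : cp w1 (l1 b) = cp w2 (l2 b) by rewrite -e1 // -e2.
have [m hm] := cp_phase eb.
(* At time [b] the phase lies in the unit interval [J]: smaller indices keep the letters of the
   first piece, the others take those of the second, whose phase is ahead by [m]. *)
pose J := Num.floor (l1 b).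
exists (fun t => l1 (Num.min t b) + l2 (Num.max t b) - l2 b).
exists (fun i => if i < J then w1 i else w2 (i + m)).
have El t : t <= b -> l1 (Num.min t b) + l2 (Num.max t b) - l2 b = l1 t.
  by move=> tb; rewrite (min_idPl tb) (max_idPr tb) addrK.
have Er t : b <= t -> l1 (Num.min t b) + l2 (Num.max t b) - l2 b = l2 t - m%:~R.
  by move=> tb; rewrite (min_idPr tb) (max_idPl tb) hm; ring.
(* If the curve is not at the wedge point at time [b], it is in the middle of a circle, on which
   both pieces must agree. *)
have wb : w1 J = w2 (J + m) \/ exists k : int, l1 b = k%:~R.
  have [hw|hw] := pselect (cp w1 (l1 b) = wedge_pt R).
    by right; exact: circle_pt_wedge hw.
  left; move: (circle_pt_inj eb hw).
  by rewrite hm floorDrz ?intrKfloor // intr_int.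
split.
- move=> t; apply: cvgB; last exact: cvg_cst.
  apply: cvgD.
    apply: (@continuous_comp _ _ _ (fun t => Num.min t b) l1); last exact: cl1.
    exact: continuous_minr.
  apply: (@continuous_comp _ _ _ (fun t => Num.max t b) l2); last exact: cl2.
  exact: continuous_maxr.
- move=> s t as_ st tc; have [tb|bt] := le_or_lt t b.
    have sb : s <= b by lra.
    by rewrite (El s sb) (El t tb); exact: i1.
  have [sb|bs] := le_or_lt s b; last first.
    have bs' := ltW bs; rewrite (Er s bs') (Er t (ltW bt)) ltrD2r; exact: i2.
  rewrite (El s sb) (Er t (ltW bt)).
  have : l2 b < l2 t by apply: i2.
  have : l1 s <= l1 b.
    by move: sb; rewrite le_eqVlt => /orP[/eqP -> //|sb]; apply/ltW/i1.
  by rewrite hm; lra.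
- by move=> j; case: ifP.
- move=> t at_ tc; have [tb|/ltW bt] := le_or_lt t b.
    rewrite (El t tb) e1 // /cp; case: ifPn => //; rewrite -leNgt => Jt.
    have lt : l1 t <= l1 b.
      by move: tb; rewrite le_eqVlt => /orP[/eqP -> //|tb]; apply/ltW/i1.
    have eJ : Num.floor (l1 t) = J by apply/le_anti; rewrite Jt andbT; exact: le_floor.
    rewrite eJ; case: wb => [-> //|[k hk]].
    have -> : l1 t = k%:~R; last by rewrite !circle_ptz.
    apply/le_anti; rewrite -hk lt /= hk.
    by have := Jt; rewrite /J hk intrKfloor floor_ge_int.
  rewrite (Er t bt) e2 //.
  have -> : l2 t = l2 t - m%:~R + m%:~R by rewrite subrK.
  rewrite cp_shift addrK /cp; case: ifPn => // lt; exfalso.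
  suff : l1 b <= l2 t - m%:~R by move/le_floor; rewrite -/J; lia.
  have : l2 b <= l2 t.
    by move: bt; rewrite le_eqVlt => /orP[/eqP -> //|bt]; apply/ltW/i2.
  by rewrite hm; lra.
Qed.

Lemma line_semiline n gam lam w a b : line n gam lam w -> semiline n gam a b.
Proof. by case=> cl il nw e; exists lam, w; split=> // s t _ st _; exact: il. Qed.

Lemma letter_unique (l : R) (w w' : int -> nat) (j : int) : cp w l = cp w' l ->
  j%:~R < l -> l < j%:~R + 1 -> w j = w' j.
Proof.
move=> e h1 h2.
have fl : Num.floor l = j.
  by apply: floor_def; rewrite intrD mulr1z h2 ltW.
rewrite -fl; apply: (circle_pt_inj e) => hw.
by have [m /(int_gap h1 h2)] := circle_pt_wedge hw.
Qed.

End Lines.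

Section Lines.
Variable R : realType.
Implicit Types (a b c s t : R) (gam : R -> R * R) (n : nat).

Lemma line_shift n gam (lam : R -> R) w (m : int) : line n gam lam w ->
  line n gam (fun t => lam t - m%:~R) (fun j => w (j + m)).
Proof.
case=> cl il nw e; split=> //.
- by move=> t; apply: cvgB; [exact: cl|exact: cvg_cst].
- by move=> s t st; rewrite ltrD2r; exact: il.
- by move=> t; rewrite e -cp_shift subrK.
Qed.

Lemma line_normalize n gam (lam : R -> R) w t0 : line n gam lam w ->
  gam t0 = wedge_pt R -> exists lam' w', line n gam lam' w' /\ lam' t0 = 0.
Proof.
move=> L h; have [m e] : exists m : int, lam t0 = m%:~R.
  by case: L => _ _ _ E; apply: circle_pt_wedge; rewrite -h E.
exists (fun t => lam t - m%:~R), (fun j => w (j + m)); split.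
  exact: line_shift.
by rewrite e subrr.
Qed.

Lemma line_unique n n' gam (lam lam' : R -> R) w w' :
  line n gam lam w -> line n' gam lam' w' ->
  exists m : int, forall t, lam' t = lam t + m%:~R.
Proof.
move=> [cl _ _ e] [cl' _ _ e'].
have [m hm] : exists m : int, lam' 0 = lam 0 + m%:~R.
  by apply: (@cp_phase R w w'); rewrite -e -e'.
exists m => t.
have E a b : a <= b -> lam' a - lam a = lam' b - lam b.
  by move=> ab; apply: (@phase_unique R lam lam' w w') => // u _ _; rewrite -e -e'.
have : lam' t - lam t = lam' 0 - lam 0.
  by have [/E|/ltW/E] := leP t 0.
by rewrite hm; lra.
Qed.

(** The lifts on [[-k, k]] are chosen independently. Subtracting an integer from each makes them
    agree at 0, hence wherever two of them are defined. *)
Lemma line_of_semilines n gam :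
  (forall a b, a <= b -> semiline n gam a b) -> exists lam w, line n gam lam w.
Proof.
move=> H.
have H1 (k : nat) : exists lw : (R -> R) * (int -> nat), [/\ continuous lw.1,
    forall s t, - k%:R <= s -> s < t -> t <= k%:R -> lw.1 s < lw.1 t,
    forall j, (lw.2 j < n)%N &
    forall t, - k%:R <= t -> t <= k%:R -> gam t = cp lw.2 (lw.1 t)].
  have [|l [w h]] := H (- k%:R) k%:R; last by exists (l, w).
  by have : 0 <= k%:R :> R by []; lra.
have [F HF] := choice H1.
have H2 (k : nat) : exists m : int, (F k).1 0 = (F 0%N).1 0 + m%:~R.
  apply: (@cp_phase R (F 0%N).2 (F k).2).
  have [_ _ _ <-] := HF 0%N; rewrite ?oppr0 //.
  by have [_ _ _ <-] := HF k; rewrite ?oppr_le0.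
have {H1 H2}[M HM] := choice H2.
pose l k t := (F k).1 t - (M k)%:~R.
pose w k (j : int) := (F k).2 (j + M k).
have cl k : continuous (l k).
  by move=> t; apply: cvgB; [case: (HF k) => h _ _ _; exact: h|exact: cvg_cst].
have il k s t : - k%:R <= s -> s < t -> t <= k%:R -> l k s < l k t.
  by move=> *; rewrite ltrD2r; case: (HF k) => _ + _ _; exact.
have el k t : - k%:R <= t -> t <= k%:R -> gam t = cp (w k) (l k t).
  by move=> h1 h2; rewrite -cp_shift subrK; case: (HF k) => _ _ _ ->.
have agree i k t : (i <= k)%N -> - i%:R <= t -> t <= i%:R -> l i t = l k t.
  move=> ik h1 h2.
  have ikR : i%:R <= k%:R :> R by rewrite ler_nat.
  have E a b : a <= b -> - i%:R <= a -> b <= i%:R -> l k a - l i a = l k b - l i b.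
    move=> ab ia bi; apply: (@phase_unique R (l i) (l k) (w i) (w k)) => // u au ub.
    by rewrite -el -?el //; lra.
  have z : l k 0 - l i 0 = 0 by rewrite /l (HM k) (HM i) !addrK subrr.
  have i0 : 0 <= i%:R :> R by [].
  have : l k t - l i t = l k 0 - l i 0.
    have [t0|/ltW t0] := leP t 0; first by apply: E.
    by symmetry; apply: E => //; lra.
  lra.
pose N t := (Num.truncn `|t|).+1.
have Nt t : - (N t)%:R < t /\ t < (N t)%:R.
  by have := truncnS_gt `|t|; rewrite ltr_norml => /andP.
pose L t := l (N t) t.
have LE k t : - k%:R <= t -> t <= k%:R -> L t = l k t.
  move=> h1 h2; have [n1 n2] := Nt t; rewrite /L.
  by have [kN|/ltnW Nk] := leqP k (N t); [symmetry|]; apply: agree => //; exact: ltW.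
have big s t : exists k : nat, (- k%:R < s /\ s < k%:R) /\ (- k%:R < t /\ t < k%:R).
  exists (N (`|s| + `|t|)); have [_ +] := Nt (`|s| + `|t|).
  set K := _%:R; move: (ler_norm s) (ler_norm t) (ler_norm (- s)) (ler_norm (- t)).
  by rewrite !normrN; have := normr_ge0 s; have := normr_ge0 t; lra.
pose inside j k t := [/\ - k%:R <= t, t <= k%:R, j%:~R < l k t & l k t < j%:~R + 1].
(* Letter [j] is determined as soon as some phase lies strictly inside its unit interval; an index
   that is never visited gets a default letter below [n]. *)
have H3 (j : int) : exists c : nat, (c < n)%N /\ forall k t, inside j k t -> w k j = c.
  have [[k0 [t0 [a1 a2 a3 a4]]]|no] := pselect (exists k t, inside j k t); last first.
    exists ((F 0%N).2 j); split; first by case: (HF 0%N) => _ _ h _; exact: h.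
    by move=> k t ?; exfalso; apply: no; exists k, t.
  exists (w k0 j); split; first by case: (HF k0) => _ _ h _; exact: h.
  move=> k t [b1 b2 b3 b4].
  have up i i' t' : inside j i t' -> (i <= i')%N -> w i' j = w i j.
    move=> [h1 h2 h3 h4] ii'.
    have iiR : i%:R <= i'%:R :> R by rewrite ler_nat.
    apply: (@letter_unique R (l i t')) => //.
    rewrite {1}(agree i i') // -el -?el //; lra.
  by rewrite -(@up k (maxn k k0) t) ?leq_maxl // -(@up k0 (maxn k k0) t0) ?leq_maxr.
have [W HW] := choice H3.
exists L, W; split.
- move=> t; have [k [[k1 k2] _]] := big t t.
  have e0 : L t = l k t by apply: LE; exact: ltW.
  apply/cvgrPdist_lt => eps eps0.
  have h : \forall s \near t, `|l k t - l k s| < eps.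
    by move/cvgrPdist_lt: (cl k t); apply.
  have d0 : 0 < Num.min (t + k%:R) (k%:R - t) by rewrite lt_min; lra.
  near=> s; have : `|s - t| < Num.min (t + k%:R) (k%:R - t).
    by near: s; exact: open_near.
  rewrite lt_min => /andP[/ltr_normlP[h1 h1'] /ltr_normlP[h2 h2']].
  rewrite e0 (LE k s); [|lra|lra].
  by near: s; exact: h.
- move=> s t st; have [k [[k1 k2] [k3 k4]]] := big s t.
  by rewrite (LE k s) ?(LE k t); rewrite ?ltW //; apply: il => //; exact: ltW.
- by move=> j; case: (HW j) => h _; exact: h.
- move=> t; have [k [[k1 k2] _]] := big t t.
  rewrite (LE k t); [|exact: ltW|exact: ltW].
  rewrite (el k); [|exact: ltW|exact: ltW].
  have [[m ->]|no] := pselect (exists m : int, l k t = m%:~R); first by rewrite !cpz.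
  have /andP[f1 f2] := floor_itv (l k t); move: f2; rewrite intrD mulr1z => f2.
  rewrite /cp; have [_ /(_ k t) <- //] := HW (Num.floor (l k t)).
  split; rewrite ?ltW // lt_neqAle f1 andbT; apply/eqP => e.
  by apply: no; exists (Num.floor (l k t)).
Unshelve. all: end_near. Qed.

Lemma line_of_local n gam :
  (forall t, exists2 d, 0 < d & (forall a, t - d < a -> a <= t -> semiline n gam a t) /\
                                (forall b, t <= b -> b < t + d -> semiline n gam t b)) ->
  exists lam w, line n gam lam w.
Proof.
move=> H; apply: line_of_semilines => a b.
apply: cousin => // {}a {}b c; exact: semiline_cat.
Qed.

Lemma positive_curve_line n gam : positive_curve n gam -> exists lam w, line n gam lam w.
Proof.
move=> H; apply: line_of_local => t0.
have [k [k' [d [lam [[kn k'n d0] [il [cl [er el]]]]]]]] := H t0.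
have cl' t : t0 - d < t -> t < t0 + d -> {for t, continuous lam}.
  move=> h1 h2; move: cl; rewrite continuous_open_subspace; last exact: interval_open.
  by apply; rewrite inE /= in_itv /= h1.
(* Clamping the time to [[a, b]] makes the local lift continuous on the whole line. *)
have ccl a b : a <= b -> t0 - d < a -> b < t0 + d ->
    continuous (fun t => lam (Num.min (Num.max t a) b)).
  move=> ab ha hb t.
  apply: (@continuous_comp _ _ _ (fun t => Num.min (Num.max t a) b) lam).
    apply: (@continuous_comp _ _ _ (fun t => Num.max t a) (fun t => Num.min t b)).
      exact: continuous_maxr.
    exact: continuous_minr.
  apply: cl'.
    by rewrite lt_min (lt_le_trans ha ab) andbT lt_max ha orbT.
  by rewrite gt_min hb orbT.
have ev a b t : a <= t -> t <= b -> Num.min (Num.max t a) b = t.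
  by move=> at_ tb; rewrite (max_idPl at_) (min_idPl tb).
exists d => //; split=> [a ha at0|b t0b hb].
  exists (fun t => lam (Num.min (Num.max t a) t0)), (fun=> k'); split=> //.
  - by apply: ccl => //; lra.
  - by move=> s t h1 h2 h3; have h4 := ltW h2; rewrite (ev _ _ s) ?(ev _ _ t); [apply: il|..]; lra.
  - by move=> t h1 h2; rewrite ev // /cp; apply: el => //; lra.
exists (fun t => lam (Num.min (Num.max t t0) b)), (fun=> k); split=> //.
- by apply: ccl => //; lra.
- by move=> s t h1 h2 h3; have h4 := ltW h2; rewrite (ev _ _ s) ?(ev _ _ t); [apply: il|..]; lra.
- by move=> t h1 h2; rewrite ev // /cp; apply: er => //; lra.
Qed.

Lemma positive_map_line m n f w : positive_map m n f -> (forall j : int, (w j < m)%N) ->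
  exists lam w', line n (fun t : R => f (cp w t)) lam w'.
Proof.
move=> [_ _ _ pf] wm; apply: line_of_local => t0.
(* Between consecutive integers [cp w] stays on one circle; gluing is needed only at integers, where
   the letter may change. *)
have L (j : int) a b : j%:~R <= a -> a <= b -> b <= j%:~R + 1 -> semiline n (f \o cp w) a b.
  move=> ja ab bj; have [lam [w' Lw]] := positive_curve_line (pf _ (wm j)).
  have [l [w'' [cl il nw e]]] := line_semiline a b Lw.
  exists l, w''; split=> // t at_ tb.
  by rewrite -e // /= (@cpE _ _ j) //; lra.
have /andP[f1 f2] := floor_itv t0; move: f2; rewrite intrD mulr1z => f2.
set j := Num.floor t0 in f1 f2.
have [e|ne] := eqVneq t0 j%:~R.
  exists 1 => //; split=> [a ha at0|b t0b hb]; last by apply: (L j); lra.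
  by apply: (L (j - 1)); rewrite ?intrB ?mulr1z; lra.
have jt : j%:~R < t0 by rewrite lt_neqAle eq_sym ne.
exists (Num.min (t0 - j%:~R) (j%:~R + 1 - t0)); first by rewrite lt_min; lra.
split=> [a + at0|b t0b].
  by rewrite ltrBlDr -ltrBlDl lt_min => /andP[h1 h2]; apply: (L j); lra.
by rewrite -ltrBlDl lt_min => /andP[h1 h2]; apply: (L j); lra.
Qed.

End Lines.

(** * Words of loops and homotopies *)

Section Cuts.
Variable R : realType.
Implicit Types (z : R * R) (s t : R) (u v : nat -> R * R) (n : nat).

(* Crossing the antipode of the wedge point on circle [k] is recorded by the
   letter [k]; the antipode is passed when the second coordinate changes sign
   away from the wedge point. *)
Definition far z := `|z.2| < z.1.
Definition kap z : nat := (Num.truncn ((z.1 ^+ 2 + z.2 ^+ 2) / (2 * z.1))).-1.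
Definition cut z z' : seq letter :=
  if far z && ((z.2 < 0) != (z'.2 < 0)) then [:: (kap z, z.2 < 0)] else [::].
Definition nearby z z' := `|z.1 - z'.1| < 4^-1 /\ `|z.2 - z'.2| < 4^-1.

Lemma nearby_sym z z' : nearby z z' -> nearby z' z.
Proof. by rewrite /nearby ![`|z.1 - _|]distrC ![`|z.2 - _|]distrC. Qed.

Lemma kapE k s : 0 < (circle_pt k s).1 -> kap (circle_pt k s) = k.
Proof.
move=> x0; rewrite /kap circle_pt_sq.
have -> : 2 * k.+1%:R * (circle_pt k s).1 / (2 * (circle_pt k s).1) = k.+1%:R.
  by field; rewrite gt_eqF.
by rewrite natrK.
Qed.

(** A sign change within a step below 1/4 makes both second coordinates small, so the far point is
    close to the antipode of its circle. Antipodes of different circles are at least 2 apart, so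
    both points lie on the same circle. *)
Lemma far_cut n z z' : wedge n z -> wedge n z' -> nearby z z' -> far z ->
  (z.2 < 0) != (z'.2 < 0) -> far z' /\ kap z = kap z'.
Proof.
move=> [k [s [_ ez]]] [k' [s' [_ ez']]] [c1 c2] fz sg.
have e := circle_pt_sq k s; have e' := circle_pt_sq k' s'; rewrite -ez -ez' in e e'.
move: c1 c2 fz; rewrite /far !ltr_norml => /andP[c1 c1'] /andP[c2 c2'] /andP[f1 f2].
have K1 : 1 <= k.+1%:R :> R by rewrite ler1n.
have K1' : 1 <= k'.+1%:R :> R by rewrite ler1n.
have [y1 [y2 [y3 y4]]] : - 4^-1 < z.2 /\ z.2 < 4^-1 /\ - 4^-1 < z'.2 /\ z'.2 < 4^-1.
  by move: sg; case: (ltP z.2 0); case: (ltP z'.2 0) => //; lra.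
have x0 : 0 < z.1 by lra.
have xK : k.+1%:R < z.1.
  have : z.2 ^+ 2 < z.1 ^+ 2 by nra.
  by nra.
have x'3 : 3 / 4 < z'.1 by lra.
have kk : k = k'.
  have h1 : 2 * k.+1%:R < z.1 + 16^-1 by nra.
  have h2 : z.1 <= 2 * k.+1%:R by nra.
  have h3 : 2 * k'.+1%:R < z'.1 + 8^-1 by nra.
  have h4 : z'.1 <= 2 * k'.+1%:R by nra.
  have [lt|lt|//] := ltngtP k k'; exfalso.
    have : k.+1%:R + 1 <= k'.+1%:R :> R by rewrite natr1 ler_nat.
    by lra.
  have : k'.+1%:R + 1 <= k.+1%:R :> R by rewrite natr1 ler_nat.
  by lra.
split; first by apply/andP; split; lra.
by rewrite ez ez' !kapE -?ez -?ez' //; lra.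
Qed.

Lemma cut_id z : cut z z = [::].
Proof. by rewrite /cut eqxx andbF. Qed.

(** Homotopy invariance for one small triangle. Two of the three signs agree, and [far_cut] matches
    the letters of the sides along which the sign changes. *)
Lemma cut_cocycle n z z' z'' : wedge n z -> wedge n z' -> wedge n z'' ->
  nearby z z' -> nearby z' z'' -> nearby z z'' ->
  weq (cut z z' ++ cut z' z'') (cut z z'').
Proof.
move=> wz wz' wz'' c1 c2 c3; rewrite /cut.
have [e1|d1] := eqVneq (z.2 < 0) (z'.2 < 0).
  rewrite andbF /= e1; have [e2|d2] := eqVneq (z'.2 < 0) (z''.2 < 0).
    by rewrite !andbF; exact: weq_refl.
  have d3 : (z.2 < 0) != (z''.2 < 0) by rewrite e1.
  have d2' : (z''.2 < 0) != (z'.2 < 0) by rewrite eq_sym.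
  have d3' : (z''.2 < 0) != (z.2 < 0) by rewrite eq_sym.
  rewrite !andbT; case: ifPn => [f'|/negP nf'].
    have [f'' ->] := far_cut wz' wz'' c2 f' d2.
    by have [-> ->] := far_cut wz'' wz (nearby_sym c3) f'' d3'.
  case: ifPn => // f; case: nf'.
  have [f'' _] := far_cut wz wz'' c3 f d3.
  by have [] := far_cut wz'' wz' (nearby_sym c2) f'' d2'.
have [e2|d2] := eqVneq (z'.2 < 0) (z''.2 < 0).
  by rewrite andbF cats0 -e2 d1.
have <- : (z.2 < 0) = (z''.2 < 0).
  by move: d1 d2; case: (z.2 < 0); case: (z'.2 < 0); case: (z''.2 < 0).
have d1' : (z'.2 < 0) != (z.2 < 0) by rewrite eq_sym.
rewrite eqxx andbF !andbT; case: ifPn => [f|/negP nf].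
  have [f' <-] := far_cut wz wz' c1 f d1.
  rewrite f' /=; have -> : (z'.2 < 0) = ~~ (z.2 < 0).
    by move: d1; case: (z.2 < 0); case: (z'.2 < 0).
  exact: (weq_linvr (kap z, z.2 < 0)).
case: ifPn => // f'; case: nf.
by have [] := far_cut wz' wz (nearby_sym c1) f' d1'.
Qed.

Fixpoint steps u n : seq letter :=
  if n is n'.+1 then steps u n' ++ cut (u n') (u n) else [::].

Lemma eq_steps u v n : (forall i, (i <= n)%N -> u i = v i) -> steps u n = steps v n.
Proof.
elim: n => //= n IH h; rewrite IH; last by move=> i /leqW; exact: h.
by rewrite !h.
Qed.

Lemma steps_cat u n k : steps u (n + k) = steps u n ++ steps (fun i => u (n + i)%N) k.
Proof.
elim: k => [|k IH]; first by rewrite addn0 cats0.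
by rewrite addnS /= IH catA addnS.
Qed.

(** The diagonal from [u i] to [v i.+1] cuts each small square into two triangles, to which
    [cut_cocycle] applies. *)
Lemma steps_grid m n u v : (forall i, (i <= n)%N -> wedge m (u i) /\ wedge m (v i)) ->
  (forall i, (i <= n)%N -> nearby (u i) (v i)) ->
  (forall i, (i < n)%N -> [/\ nearby (u i) (u i.+1), nearby (v i) (v i.+1)
    & nearby (u i) (v i.+1)]) ->
  weq (steps u n ++ cut (u n) (v n)) (cut (u 0%N) (v 0%N) ++ steps v n).
Proof.
elim: n => [|n IH] w c1 c2; first by rewrite /= cats0; exact: weq_refl.
have {}IH : weq (steps u n ++ cut (u n) (v n)) (cut (u 0%N) (v 0%N) ++ steps v n).
  by apply: IH => i lin; [apply: w|apply: c1|apply: c2] => //; exact: ltnW.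
have [wu wv] := w n (leqnSn n); have [wu' wv'] := w n.+1 (leqnn _).
have [c3 c4 c5] := c2 n (leqnn _).
rewrite /= -catA; apply: (@weq_trans (steps u n ++ cut (u n) (v n.+1))).
  apply: weq_cat; first exact: weq_refl.
  by apply: (@cut_cocycle m) => //; exact: c1.
apply: (@weq_trans (steps u n ++ (cut (u n) (v n) ++ cut (v n) (v n.+1)))).
  apply: weq_cat; first exact: weq_refl.
  apply: weq_sym; apply: (@cut_cocycle m) => //; exact: c1.
by rewrite !catA; apply: weq_cat => //; exact: weq_refl.
Qed.

Lemma steps_rev m n u : (forall i, (i <= n)%N -> wedge m (u i)) ->
  (forall i, (i < n)%N -> nearby (u i) (u i.+1)) ->
  weq (steps u n ++ steps (fun i => u (n - i)%N) n) [::].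
Proof.
elim: n => [|n IH] w c; first exact: weq_refl.
have -> : steps (fun i => u (n.+1 - i)%N) n.+1 =
    cut (u n.+1) (u n) ++ steps (fun i => u (n - i)%N) n.
  rewrite -[n.+1]add1n steps_cat /= subn0 add1n subn1; congr (_ ++ _).
rewrite /= -catA (catA (cut _ _)).
have z : nearby (u n) (u n) by rewrite /nearby !subrr normr0; split; lra.
apply: (@weq_trans (steps u n ++ ([::] ++ steps (fun i => u (n - i)%N) n))).
  apply: weq_cat; first exact: weq_refl.
  apply: weq_cat; last exact: weq_refl.
  rewrite -(cut_id (u n)); have wn : wedge m (u n) by apply: w.
  have cn : nearby (u n) (u n.+1) by apply: c.
  by apply: (@cut_cocycle m) => //; [apply: w|exact: nearby_sym].
by apply: IH => i lin; [apply: w; exact: leqW|apply: c; exact: ltnW].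
Qed.

Lemma steps_refine m n u : (forall i, (i <= 2 * n)%N -> wedge m (u i)) ->
  (forall i, (i < n)%N -> [/\ nearby (u (2 * i)%N) (u (2 * i).+1),
     nearby (u (2 * i).+1) (u (2 * i).+2) & nearby (u (2 * i)%N) (u (2 * i).+2)]) ->
  weq (steps u (2 * n)%N) (steps (fun i => u (2 * i)%N) n).
Proof.
elim: n => [|n IH] w c; first exact: weq_refl.
rewrite mulnS -[(2 + _)%N]/(2 * n).+2 /= -catA; apply: weq_cat.
  by apply: IH => i h; [apply: w; lia|apply: c; lia].
rewrite (_ : (2 * n.+1)%N = (2 * n).+2); last by lia.
by have [c1 c2 c3] := c n (leqnn _); apply: (@cut_cocycle m) => //; apply: w; lia.
Qed.

Lemma cos_lt0_far k s : far (circle_pt k s) = (cos (2 * pi * s) < 0).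
Proof.
rewrite /far /circle_pt /=.
set K := k.+1%:R; set C := cos _; set S := sin _.
have K0 : 0 < K by [].
have e : C ^+ 2 + S ^+ 2 = 1 by exact: cos2Dsin2.
have c1 : C <= 1 by exact: cos_le1.
rewrite normrN normrM (gtr0_norm K0).
have -> : K - K * C = K * (1 - C) by ring.
rewrite ltr_pM2l //.
have e2 : `|S| ^+ 2 = 1 - C ^+ 2 by rewrite real_normK ?num_real //; lra.
have s0 : 0 <= `|S| by [].
by apply/idP/idP => h; nra.
Qed.

Lemma circle_pt_lt0 k s : ((circle_pt k s).2 < 0) = (0 < sin (2 * pi * s)).
Proof. by rewrite /circle_pt /= oppr_lt0 pmulr_rgt0. Qed.

Lemma cp_lt0 (w : int -> nat) s (n : int) : - 2^-1 <= s - n%:~R -> s - n%:~R < 2^-1 ->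
  ((cp w s).2 < 0) = (0 < s - n%:~R).
Proof.
move=> h1 h2; rewrite /cp circle_pt_lt0 -(sin_2piDz _ (- n)) mulrNz.
have [h|h] := ltP 0 (s - n%:~R); first by rewrite sin_2pi_gt0.
apply/negbTE; rewrite -leNgt -(sin_2piDz _ 1) mulr1z.
by apply: sin_2pi_le0; lra.
Qed.

(** Within half a turn of phase [n] the second coordinate changes sign only at the wedge point, and
    points just before it are not far. *)
Lemma cut_cp_stay (w : int -> nat) s s' (n : int) : - 2^-1 <= s - n%:~R -> s <= s' ->
  s' < s + 4^-1 -> s' - n%:~R < 2^-1 -> cut (cp w s) (cp w s') = [::].
Proof.
move=> h1 h2 h3 h4; rewrite /cut (@cp_lt0 _ s n); [|lra|lra]; rewrite (@cp_lt0 _ s' n); [|lra|lra].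
case: ifPn => // /andP[f sg]; exfalso.
have [h5 h6] : s - n%:~R <= 0 /\ 0 < s' - n%:~R.
  by move: sg; case: (ltP 0 (s - _)) => h5; case: (ltP 0 (s' - _)) => h6 // _; lra.
move: f; rewrite /cp cos_lt0_far -(cos_2piDz _ (- n)) mulrNz => f.
have : 0 < cos (2 * pi * (s - n%:~R)) by apply: cos_2pi_gt0; lra.
by lra.
Qed.

Lemma cut_cp_cross (w : int -> nat) s s' (n : int) : s - n%:~R < 2^-1 ->
  s' < s + 4^-1 -> 2^-1 <= s' - n%:~R -> cut (cp w s) (cp w s') = [:: (w n, true)].
Proof.
move=> h1 h2 h3.
have f : far (cp w s).
  rewrite /cp cos_lt0_far -(cos_2piDz _ (- n)) mulrNz.
  by apply: cos_2pi_lt0; lra.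
have n1 : (n + 1)%:~R = n%:~R + 1 :> R by rewrite intrD mulr1z.
rewrite /cut f (@cp_lt0 _ _ n); [|lra|lra].
rewrite (@cp_lt0 _ _ (n + 1)); rewrite ?n1; [|lra|lra].
have -> : 0 < s - n%:~R by lra.
have -> /= : (0 < s' - (n%:~R + 1)) = false by apply/negbTE; rewrite -leNgt; lra.
congr [:: (_, _)]; rewrite /cp (@floor_def _ s n) ?n1; last by lra.
rewrite kapE //; move: f; rewrite /far /cp (@floor_def _ s n) ?n1; last by lra.
by move=> h; apply: le_lt_trans h.
Qed.

Definition word (w : int -> nat) n : seq nat := mkseq (fun i => w i%:Z) n.

Lemma steps_line (G : R -> R * R) (mu : R -> R) (w : int -> nat) (n M : nat) :
  (0 < M)%N ->
  (forall i, (i <= M)%N -> G (i%:R / M%:R) = cp w (mu (i%:R / M%:R))) ->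
  (forall i, (i < M)%N -> mu (i%:R / M%:R) <= mu (i.+1%:R / M%:R) /\
     mu (i.+1%:R / M%:R) < mu (i%:R / M%:R) + 4^-1) ->
  mu 0 = 0 -> mu 1 = n%:R ->
  steps (fun i => G (i%:R / M%:R)) M = pos (word w n).
Proof.
move=> M0 eG hm m0 m1.
(* [j] counts the antipodes passed so far; the half-open window of phases around [j] ends at the
   antipode of circle [w j]. *)
have H i : (i <= M)%N -> exists j : nat, [/\ - 2^-1 <= mu (i%:R / M%:R) - j%:R,
   mu (i%:R / M%:R) - j%:R < 2^-1 &
   steps (fun i => G (i%:R / M%:R)) i = pos (word w j)].
  elim: i => [|i IH] iM; first by exists 0%N; rewrite mul0r m0; split=> //; lra.
  have [j [h1 h2 h3]] := IH (ltnW iM).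
  have [h4 h5] := hm _ iM.
  rewrite /= h3 !eG //; last exact: ltnW.
  have [h6|h6] := ltP (mu (i.+1%:R / M%:R) - j%:R) 2^-1.
    exists j; split=> //; first lra.
    by rewrite (@cut_cp_stay _ _ _ j) ?cats0 //; lra.
  exists j.+1; rewrite -[j.+1%:R]natr1; split; [lra|lra|].
  rewrite (@cut_cp_cross _ _ _ j); [|exact: h2|exact: h5|exact: h6].
  by rewrite /word mkseqS -cats1 pos_cat.
have [j [h1 h2 ->]] := H _ (leqnn M).
move: h1 h2; rewrite divff; last by rewrite pnatr_eq0 -lt0n.
rewrite m1 => h1 h2; congr (pos (word _ _)).
have [lt|lt|//] := ltngtP j n; exfalso.
  have : j%:R + 1 <= n%:R :> R by rewrite natr1 ler_nat.
  by lra.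
have : n%:R + 1 <= j%:R :> R by rewrite natr1 ler_nat.
by lra.
Qed.

End Cuts.

(** * Words of homotopic loops *)

Section Homotopy.
Variable R : realType.
Implicit Types (z : R * R) (s t : R) (n : nat).

Lemma unit_square_compact : compact (@unit_square R).
Proof.
have -> : @unit_square R = `[0, 1] `*` `[0, 1].
  by apply/seteqP; split=> -[x y] /=; rewrite /unit_square /= !in_itv.
by apply: compact_setX; exact: segment_compact.
Qed.

Lemma unit_square_unif_cont (H : R * R -> R * R) :
  {within @unit_square R, continuous H} ->
  exists K0 : nat, forall K, (K0 <= K)%N -> forall q q', unit_square q -> unit_square q' ->
    `|q.1 - q'.1| <= K%:R^-1 -> `|q.2 - q'.2| <= K%:R^-1 -> nearby (H q) (H q').
Proof.
move=> cH.
pose P (K : nat) (q : R * R) := unit_square q -> forall q', unit_square q' ->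
  `|q.1 - q'.1| <= K%:R^-1 -> `|q.2 - q'.2| <= K%:R^-1 -> nearby (H q) (H q').
have [N _ hN] : \forall K \near \oo, @unit_square R `<=` P K.
  have /compact_near_coveringP cov := unit_square_compact.
  apply: (cov nat \oo P _) => q uq.
  have : H @ within (@unit_square R) (nbhs q) --> H q.
    by rewrite (nbhs_subspace_in uq); exact: (cH q).
  move/cvg_ballP => hb.
  have /nbhs_ballP[e /= e0 he] : nbhs q (fun y => unit_square y -> ball (H q) 8^-1 (H y)).
    by apply: hb; rewrite invr_gt0.
  have hq y : unit_square y -> `|q.1 - y.1| < e -> `|q.2 - y.2| < e ->
      `|(H q).1 - (H y).1| < 8^-1 /\ `|(H q).2 - (H y).2| < 8^-1.
    by move=> uy y1 y2; apply: (he y).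
  exists (ball q (e / 2), [set K : nat | K%:R^-1 < e / 2]).
    split; first by apply: nbhsx_ballx; rewrite divr_gt0.
    have e2 : 0 < e / 2 by rewrite divr_gt0.
    exists (Num.truncn (e / 2)^-1).+1 => // K /= hK.
    have h := truncnS_gt (e / 2)^-1.
    have hK' : (e / 2)^-1 < K%:R by apply: (lt_le_trans h); rewrite ler_nat.
    by rewrite invf_plt // posrE; apply: lt_trans hK'; rewrite invr_gt0.
  move=> [x K] /= [[b1 b2] hK] ux y uy y1 y2.
  rewrite /ball /= in b1 b2.
  have [p1 p2] : `|(H q).1 - (H x).1| < 8^-1 /\ `|(H q).2 - (H x).2| < 8^-1.
    by apply: hq => //; lra.
  have [p3 p4] : `|(H q).1 - (H y).1| < 8^-1 /\ `|(H q).2 - (H y).2| < 8^-1.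
    apply: hq => //.
      by have := ler_distD x.1 q.1 y.1; lra.
    by have := ler_distD x.2 q.2 y.2; lra.
  split.
    by have := ler_distD (H q).1 (H x).1 (H y).1; rewrite (distrC (H x).1 (H q).1); lra.
  by have := ler_distD (H q).2 (H x).2 (H y).2; rewrite (distrC (H x).2 (H q).2); lra.
by exists N => K NK q q' uq uq'; exact: (hN K NK q uq).
Qed.

Lemma cont_unit_unif (mu : R -> R) : continuous mu -> exists K0 : nat, forall K, (K0 <= K)%N ->
  forall s t, 0 <= s -> s <= t -> t <= 1 -> t - s <= K%:R^-1 -> `|mu s - mu t| < 4^-1.
Proof.
move=> cmu; pose H (q : R * R) : R * R := (mu q.2, 0).
have cH : {within @unit_square R, continuous H}.
  apply: continuous_subspaceT; apply: continuous_pair.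
    move=> q; apply: (@continuous_comp _ _ _ snd mu); last exact: cmu.
    exact: cvg_snd.
  by move=> q; exact: cvg_cst.
have [K0 hK] := unit_square_unif_cont cH; exists K0 => K K0K s t s0 st t1 d.
have [] // := hK K K0K (0, s) (0, t).
- by split=> /=; lra.
- by split=> /=; lra.
- by rewrite /= subrr normr0 invr_ge0.
- by rewrite /= distrC ger0_norm ?subr_ge0.
Qed.

(** All rows of a fine grid on the homotopy have the same word, because their ends stay at the wedge
    point. The extreme rows give the word of [G] and the conjugate of the word of [F]; multiplying
    by the word of [a] on the left keeps inverses out of the statement. *)
Lemma homotopic_steps n (a F G : R -> R * R) :
  loop n a -> F 0 = wedge_pt R -> F 1 = wedge_pt R ->
  loop_homotopic n G (pcat (path_rev a) (pcat F a)) ->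
  exists M0 : nat, forall M, (M0 <= M)%N -> (0 < M)%N ->
    weq (steps (fun i => F (i%:R / M%:R)) M ++ steps (fun i => a (i%:R / M%:R)) M)
        (steps (fun i => a (i%:R / M%:R)) M ++
         steps (fun i => G (i%:R / (4 * M)%N%:R)) (4 * M)%N).
Proof.
move=> [_ wa a0 a1] F0 F1 [H [cH wH H01 Hw]].
have [K0 hK] := unit_square_unif_cont cH.
exists K0 => M K0M M0.
have M0R : 0 < M%:R :> R by rewrite ltr0n.
(* With [4 * M] steps the breakpoints 1/2 and 3/4 of the concatenation fall on the grid; the
   reversed [a] gets [2 * M] steps, [F] and the last [a] get [M] each. *)
pose K := (4 * M)%N; have K_gt0 : 0 < K%:R :> R by rewrite ltr0n /K; lia.
have KM : K%:R = 4 * M%:R :> R by rewrite /K natrM.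
pose P (j i : nat) := H (j%:R / K%:R, i%:R / K%:R).
have frac i : (i <= K)%N -> 0 <= i%:R / K%:R :> R /\ i%:R / K%:R <= 1 :> R.
  move=> iK; split; first by rewrite divr_ge0.
  by rewrite ler_pdivrMr // mul1r ler_nat.
have cP j i j' i' : (j <= K)%N -> (i <= K)%N -> (j' <= K)%N -> (i' <= K)%N ->
    (j' <= j + 2)%N -> (j <= j' + 2)%N -> (i' <= i + 2)%N -> (i <= i' + 2)%N ->
    nearby (P j i) (P j' i').
  move=> h1 h2 h3 h4 h5 h6 h7 h8.
  have D x x' : (x <= x' + 2)%N -> (x' <= x + 2)%N ->
      `|x%:R / K%:R - x'%:R / K%:R| <= (2 * M)%N%:R^-1 :> R.
    move=> d1 d2.
    have e1 : x%:R <= x'%:R + 2 :> R by rewrite -natrD ler_nat.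
    have e2 : x'%:R <= x%:R + 2 :> R by rewrite -natrD ler_nat.
    rewrite -mulrBl normrM (gtr0_norm (x := K%:R^-1)) ?invr_gt0 //.
    rewrite ler_pdivrMr // KM natrM invfM.
    have -> : 2^-1 * M%:R^-1 * (4 * M%:R) = 2 :> R by field; rewrite gt_eqF.
    by rewrite ler_norml; lra.
  apply: (hK (2 * M)%N); [lia| | | |].
  - by split=> /=; apply/andP; exact: frac.
  - by split=> /=; apply/andP; exact: frac.
  - by rewrite /=; apply: D.
  - by rewrite /=; apply: D.
have wP j i : (j <= K)%N -> (i <= K)%N -> wedge n (P j i).
  by move=> h1 h2; apply: wH; split=> /=; apply/andP; exact: frac.
have P0 j : (j <= K)%N -> P j 0%N = wedge_pt R.
  by move=> /frac[h1 h2]; have [+ _] := Hw _ h1 h2; rewrite /P mul0r.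
have PK j : (j <= K)%N -> P j K = wedge_pt R.
  by move=> /frac[h1 h2]; have [_ +] := Hw _ h1 h2; rewrite /P divff ?gt_eqF.
have rows j : (j <= K)%N -> weq (steps (P 0%N) K) (steps (P j) K).
  elim: j => [|j IH] jK; first exact: weq_refl.
  apply: (weq_trans (IH (ltnW jK))).
  have := @steps_grid R n K (P j) (P j.+1).
  rewrite P0 ?P0 ?PK ?PK ?cut_id ?cats0 ?(ltnW jK) //; apply.
  - by move=> i iK; split; apply: wP => //; exact: ltnW.
  - by move=> i iK; apply: cP => //; lia.
  - by move=> i iK; split; apply: cP => //; lia.
have eG i : (i <= K)%N -> P 0%N i = G (i%:R / K%:R).
  by move=> /frac[h1 h2]; have [<- _] := H01 _ h1 h2; rewrite /P mul0r.
pose C := pcat (path_rev a) (pcat F a).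
have eC i : (i <= K)%N -> P K i = C (i%:R / K%:R).
  by move=> /frac[h1 h2]; have [_ e] := H01 _ h1 h2; rewrite /P divff ?gt_eqF // e.
have C1 i : (i <= 2 * M)%N -> C (i%:R / K%:R) = a ((2 * M - i)%N%:R / (2 * M)%N%:R).
  move=> h; rewrite /C {1}/pcat.
  have hR : i%:R <= 2 * M%:R :> R by rewrite -natrM ler_nat.
  rewrite ler_pdivrMr // KM ifT; last by lra.
  by rewrite /path_rev; congr a; rewrite natrB // natrM; field; rewrite gt_eqF.
have C2 i : (i <= M)%N -> C ((2 * M + i)%N%:R / K%:R) = F (i%:R / M%:R).
  move=> h; have hR : i%:R <= M%:R :> R by rewrite ler_nat.
  case: i h hR => [|i] h hR.
    by rewrite addn0 C1 // subnn !mul0r a0 F0.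
  rewrite /C {1}/pcat ler_pdivrMr // KM natrD natrM.
  have i0 : 0 < i.+1%:R :> R by [].
  rewrite ifF; last by apply/negbTE; rewrite -ltNge; lra.
  have -> : 2 * ((2 * M%:R + i.+1%:R) / (4 * M%:R)) - 1 = i.+1%:R / (2 * M%:R) :> R.
    by field; rewrite gt_eqF.
  rewrite /pcat ler_pdivrMr ?mulr_gt0 // ifT; last by lra.
  by congr F; field; rewrite gt_eqF.
have C3 i : (i <= M)%N -> C ((3 * M + i)%N%:R / K%:R) = a (i%:R / M%:R).
  move=> h; have hR : i%:R <= M%:R :> R by rewrite ler_nat.
  case: i h hR => [|i] h hR.
    rewrite addn0 (_ : (3 * M)%N = (2 * M + M)%N); last by lia.
    by rewrite C2 // divff ?gt_eqF // mul0r F1 a0.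
  rewrite /C {1}/pcat ler_pdivrMr // KM natrD natrM.
  have i0 : 0 < i.+1%:R :> R by [].
  rewrite ifF; last by apply/negbTE; rewrite -ltNge; lra.
  have -> : 2 * ((3 * M%:R + i.+1%:R) / (4 * M%:R)) - 1 =
      (M%:R + i.+1%:R) / (2 * M%:R) :> R by field; rewrite gt_eqF.
  rewrite /pcat ler_pdivrMr ?mulr_gt0 // ifF; last by apply/negbTE; rewrite -ltNge; lra.
  by congr a; field; rewrite gt_eqF.
set alpha := steps (fun i => a (i%:R / M%:R)) M.
set phi := steps (fun i => F (i%:R / M%:R)) M.
(* The reversed copy of [a] is sampled twice as finely as the other one; [steps_refine] shows that
   this leaves the word unchanged. *)
pose a2 i := a (i%:R / (2 * M)%N%:R).
pose beta := steps (fun i => a2 (2 * M - i)%N) (2 * M)%N.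
have eW : weq (steps (fun i => G (i%:R / K%:R)) K) (beta ++ (phi ++ alpha)).
  have := rows K (leqnn _).
  rewrite (eq_steps eG) (eq_steps eC).
  have -> : steps (fun i => C (i%:R / K%:R)) K = beta ++ (phi ++ alpha) => //.
  rewrite {2}(_ : K = (2 * M + (M + M))%N); last by rewrite /K; lia.
  rewrite steps_cat (steps_cat _ M M); congr (_ ++ (_ ++ _)).
  - by rewrite /beta; apply: eq_steps => i h; rewrite C1.
  - by rewrite /phi; apply: eq_steps => i h; rewrite C2.
  - by rewrite /alpha; apply: eq_steps => i h; rewrite -C3 // addnA; congr (C (_%:R / _)); lia.
have a2P i : (i <= 2 * M)%N -> a2 i = P K (2 * M - i)%N.
  by move=> h; rewrite eC ?C1 ?subKn //; rewrite /K; lia.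
have ab : weq (alpha ++ beta) [::].
  apply: (@weq_trans (steps a2 (2 * M)%N ++ beta)).
    apply: weq_cat; last exact: weq_refl.
    apply: weq_sym.
    have -> : alpha = steps (fun i => a2 (2 * i)%N) M.
      rewrite /alpha; apply: eq_steps => i h; rewrite /a2; congr a.
      by rewrite !natrM; field; rewrite gt_eqF.
    apply: (@steps_refine R n).
      by move=> i h; rewrite a2P //; apply: wP => //; rewrite /K; lia.
    by move=> i h; split; rewrite !a2P; try lia; apply: cP; rewrite /K; lia.
  apply: (@steps_rev R n).
    by move=> i h; rewrite a2P //; apply: wP => //; rewrite /K; lia.
  by move=> i h; rewrite !a2P; try lia; apply: cP; rewrite /K; lia.
apply: weq_sym; apply: (@weq_trans (alpha ++ (beta ++ (phi ++ alpha)))).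
  by apply: weq_cat; [exact: weq_refl|exact: eW].
rewrite catA -[phi ++ alpha in X in weq _ X]/([::] ++ (phi ++ alpha)).
by apply: weq_cat; [exact: ab|exact: weq_refl].
Qed.

End Homotopy.

(** * Conjugate positive maps *)

Section Level.
Variable R : realType.
Implicit Types (z : R * R) (s t : R) (k l m n : nat).

Lemma loop_circle_pt m k : (k < m)%N -> loop m (@circle_pt R k).
Proof.
move=> km; split.
- by apply: continuous_subspaceT; exact: circle_pt_continuous.
- by move=> t _ _; exists k, t.
- exact: circle_pt0.
- exact: (@circle_ptz R k 1).
Qed.

Lemma positive_map_circle m n f k : positive_map m n f -> (k < m)%N ->
  exists (mu : R -> R) (w : int -> nat) l,
    [/\ line n (f \o circle_pt k) mu w, mu 0 = 0, mu 1 = l%:R & (0 < l)%N].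
Proof.
move=> [_ _ fw pf] km; have [lam [w L]] := positive_curve_line (pf k km).
have [|mu [w' [L' mu0]]] := line_normalize (t0 := 0) L; first by rewrite /= circle_pt0.
case: (L') => _ il _ e.
have [j ej] : exists j : int, mu 1 = j%:~R.
  by apply: (@circle_pt_wedge R (w' (Num.floor (mu 1)))); rewrite -[LHS]e /= (@circle_ptz R k 1).
have : 0 < j%:~R :> R by rewrite -ej -mu0; apply: il.
rewrite ltr0z; case: j ej => // l ej l0; exists mu, w', l; split=> //.
Qed.

Lemma steps_circle (G : R -> R * R) (mu : R -> R) (w : int -> nat) l n : line n G mu w ->
  mu 0 = 0 -> mu 1 = l%:R ->
  exists M0 : nat, forall M, (M0 <= M)%N -> (0 < M)%N ->
    steps (fun i => G (i%:R / M%:R)) M = pos (word w l).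
Proof.
move=> [cl il _ e] mu0 mu1; have [K0 hK] := cont_unit_unif cl; exists K0 => M KM M0.
have M0R : 0 < M%:R :> R by rewrite ltr0n.
apply: (@steps_line R G mu w l M) => //.
move=> i iM.
have le1 : i%:R / M%:R < i.+1%:R / M%:R :> R.
  by rewrite ltr_pM2r ?invr_gt0 // ltr_nat.
split; first by apply/ltW/il.
have d : i.+1%:R / M%:R - i%:R / M%:R = M%:R^-1 :> R.
  by rewrite -natr1; field; rewrite gt_eqF.
have h0 : 0 <= i%:R / M%:R :> R by rewrite divr_ge0.
have h1 : i.+1%:R / M%:R <= 1 :> R by rewrite ler_pdivrMr // mul1r ler_nat.
have := hK M KM _ _ h0 (ltW le1) h1; rewrite d lexx => /(_ isT).
by rewrite ltr_norml; lra.
Qed.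

Lemma common_bound m (P : nat -> nat -> Prop) :
  (forall k, (k < m)%N -> exists M0, forall M, (M0 <= M)%N -> (0 < M)%N -> P k M) ->
  exists M, forall k, (k < m)%N -> P k M.
Proof.
move=> H; suff [M0 h] : exists M0, forall M, (M0 <= M)%N -> (0 < M)%N ->
    forall k, (k < m)%N -> P k M.
  by exists M0.+1; apply: h.
elim: m H => [|m IH] H; first by exists 0%N.
have [|M0 h0] := IH; first by move=> k km; apply: H; exact: leqW.
have [M1 h1] := H m (leqnn _); exists (maxn M0 M1) => M.
rewrite geq_max => /andP[a b] M_gt0 k; rewrite ltnS leq_eqVlt => /orP[/eqP ->|km].
  exact: h1.
exact: h0.
Qed.

(** The loop [a] is sampled with one mesh that is fine enough for all circles at once, so that a
    single word, in normal form, conjugates all image words. *)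
Lemma conj_words m n (f g : R * R -> R * R) (muf mug : nat -> R -> R)
    (wf wg : nat -> int -> nat) (lf lg : nat -> nat) :
  f (wedge_pt R) = wedge_pt R ->
  (forall k, (k < m)%N -> [/\ line n (f \o circle_pt k) (muf k) (wf k),
     muf k 0 = 0, muf k 1 = (lf k)%:R & (0 < lf k)%N]) ->
  (forall k, (k < m)%N -> [/\ line n (g \o circle_pt k) (mug k) (wg k),
     mug k 0 = 0, mug k 1 = (lg k)%:R & (0 < lg k)%N]) ->
  (exists a : R -> R * R, loop n a /\
     forall gam : R -> R * R, loop m gam ->
       loop_homotopic n (g \o gam) (pcat (path_rev a) (pcat (f \o gam) a))) ->
  exists2 r, reduced r & forall k, (k < m)%N ->
    weq (pos (word (wf k) (lf k)) ++ r) (r ++ pos (word (wg k) (lg k))).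
Proof.
move=> fw Lf Lg [a [la ha]].
have [M hM] : exists M, forall k, (k < m)%N ->
    weq (pos (word (wf k) (lf k)) ++ steps (fun i => a (i%:R / M%:R)) M)
        (steps (fun i => a (i%:R / M%:R)) M ++ pos (word (wg k) (lg k))); last first.
  exists (actw (steps (fun i => a (i%:R / M%:R)) M) [::]).
    exact: reduced_actw.
  move=> k km; have e := weq_actw_nil (steps (fun i => a (i%:R / M%:R)) M).
  apply: (@weq_trans (pos (word (wf k) (lf k)) ++ steps (fun i => a (i%:R / M%:R)) M)).
    by apply: weq_cat => //; exact: weq_refl.
  apply: (weq_trans (hM k km)); apply: weq_cat; last exact: weq_refl.
  exact: weq_sym.
apply: common_bound => k km.
have [Lfk f0 f1 _] := Lf k km; have [Lgk g0 g1 _] := Lg k km.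
have [M1 h1] := steps_circle Lfk f0 f1.
have [M2 h2] := steps_circle Lgk g0 g1.
have [| |M3 h3] := homotopic_steps la _ _ (ha _ (loop_circle_pt km)).
- by rewrite /= circle_pt0.
- by rewrite /= (@circle_ptz R k 1).
exists (maxn M1 (maxn M2 M3)) => M; rewrite !geq_max => /and3P[a1 a2 a3] M0 /=.
have := h3 M a3 M0; rewrite h1 //.
by rewrite (h2 (4 * M)%N) //; lia.
Qed.

(** By uniqueness of lifts, the lift over the whole path restricts on its [j]-th circle to a
    translate of the lift over that circle alone. Hence the image itinerary is a concatenation of
    the words of the circles. *)
Lemma line_segment n (f : R * R -> R * R) (om : int -> nat) (lam mu : R -> R)
    (w' w : int -> nat) l (j nj : int) :
  line n (fun t => f (cp om t)) lam w' -> line n (f \o circle_pt (om j)) mu w ->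
  mu 0 = 0 -> mu 1 = l%:R -> lam j%:~R = nj%:~R ->
  (forall s, 0 <= s -> s <= 1 -> lam (j%:~R + s) = nj%:~R + mu s) /\
  (forall i, (i < l)%N -> w' (nj + i%:Z) = w i%:Z).
Proof.
move=> [cl il _ e] [cm im _ e'] mu0 mu1 lamj.
have E s : 0 <= s -> s <= 1 -> cp w (mu s) = cp w' (lam (j%:~R + s)).
  move=> s0 s1; rewrite -e' -e /= (@cpE _ om j); [|lra|lra].
  by rewrite addrC circle_ptDz.
have Es s : 0 <= s -> s <= 1 -> lam (j%:~R + s) = nj%:~R + mu s.
  move=> s0 s1.
  have := @phase_unique R mu (fun s => lam (j%:~R + s)) w w' 0 s cm.
  rewrite addr0 lamj mu0 => H.
  suff : nj%:~R - 0 = lam (j%:~R + s) - mu s by lra.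
  apply: H => //.
    move=> t; apply: (@continuous_comp _ _ _ (fun t => j%:~R + t) lam); last exact: cl.
    by apply: cvgD; [exact: cvg_cst|exact: cvg_id].
  by move=> t t0 ts; apply: E => //; lra.
split=> // i il'.
have [||c [c0 c1 hc]] := @IVT_le R mu 0 1 (i%:R + 2^-1) cm ler01.
- by rewrite mu0 addr_ge0.
- by have : i%:R + 1 <= l%:R :> R; [rewrite natr1 ler_nat|rewrite mu1; lra].
have := E c c0 c1; rewrite Es // addrC cp_shift => ee.
have := @letter_unique R (mu c) w (fun i => w' (i + nj)) i ee.
rewrite hc (addrC nj) => -> //; first by rewrite ltrDl invr_gt0.
by rewrite ltrD2l; lra.
Qed.

End Level.

(** * Conjugation as a shift of bi-infinite words *)

Section BiinfiniteWords.
Implicit Types (k n : nat) (i j : int).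

Definition seg (w : int -> nat) i n : seq nat := mkseq (fun p => w (i + p%:Z)) n.

Lemma seg_cat w i n n' : seg w i (n + n') = seg w i n ++ seg w (i + n%:Z) n'.
Proof.
rewrite /seg /mkseq iotaD map_cat add0n; congr (_ ++ _).
rewrite -[in iota n n'](addn0 n) iotaDl -map_comp; apply: eq_map => p /=.
by rewrite PoszD addrA.
Qed.

Lemma nth_seg w i n p : (p < n)%N -> nth 0%N (seg w i n) p = w (i + p%:Z).
Proof. exact: nth_mkseq. Qed.

Lemma size_seg w i n : size (seg w i n) = n.
Proof. exact: size_mkseq. Qed.

(** The relations [v r = r w] for single circles multiply to the same relation for blocks. On a
    block much longer than [r], [weq_conj_pos] turns it into a shift by [size a] or by [- size s],
    which is [expsum r] in both cases. *)
Lemma conj_biinfinite m (om : int -> nat) (N : int -> int) (wf wg : nat -> int -> nat)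
    (l : nat -> nat) (omf omg : int -> nat) r :
  (forall j, (om j < m)%N) -> N 0 = 0 -> (forall j, N (j + 1) = N j + (l (om j))%:Z) ->
  (forall k, (k < m)%N -> (0 < l k)%N) ->
  (forall j n, (n < l (om j))%N -> omf (N j + n%:Z) = wf (om j) n) ->
  (forall j n, (n < l (om j))%N -> omg (N j + n%:Z) = wg (om j) n) ->
  reduced r ->
  (forall k, (k < m)%N ->
     weq (pos (word (wf k) (l k)) ++ r) (r ++ pos (word (wg k) (l k)))) ->
  forall i, omg i = omf (i + expsum r).
Proof.
move=> omm N0 NS lpos ef eg rr H.
have blocks (J : nat) (a : int) : exists n, [/\ (J <= n)%N, N (a + J%:Z) = N a + n%:Z &
    weq (pos (seg omf (N a) n) ++ r) (r ++ pos (seg omg (N a) n))].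
  elim: J => [|J [n [Jn En Wn]]].
    by exists 0%N; rewrite !addr0; split=> //=; rewrite cats0; exact: weq_refl.
  have lp := lpos _ (omm (a + J%:Z)).
  exists (n + l (om (a + J%:Z)%R))%N; split; first by lia.
    rewrite (_ : a + J.+1%:Z = a + J%:Z + 1); last by lia.
    by rewrite NS En PoszD addrA.
  have sf : seg omf (N a + n%:Z) (l (om (a + J%:Z))) =
      word (wf (om (a + J%:Z))) (l (om (a + J%:Z))).
    apply/eq_in_map => p; rewrite mem_iota add0n => /andP[_ hp].
    by rewrite -En ef.
  have sg : seg omg (N a + n%:Z) (l (om (a + J%:Z))) =
      word (wg (om (a + J%:Z))) (l (om (a + J%:Z))).
    apply/eq_in_map => p; rewrite mem_iota add0n => /andP[_ hp].
    by rewrite -En eg.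
  rewrite !seg_cat !pos_cat sf sg -catA.
  set vf := pos (word _ _); set vg := pos (word _ _).
  apply: (@weq_trans (pos (seg omf (N a) n) ++ (r ++ vg))).
    by apply: weq_cat; [exact: weq_refl|exact: (H _ (omm _))].
  by rewrite !catA; apply: weq_cat; [exact: Wn|exact: weq_refl].
(* The circles from [-J] to [J] have image words of length at least [2 * J], and position [i] is
   further than [size r] from both ends. *)
move=> i; pose J := (`|i| + 2 * size r + 5)%N.
have [n1 [hn1 + _]] := blocks J 0; rewrite add0r N0 add0r => e1.
have [n2 [hn2 + _]] := blocks J (- J%:Z); rewrite addNr N0 => e2.
have [n [hn e W]] := blocks (2 * J)%N (- J%:Z).
have e3 : - J%:Z + (2 * J)%N%:Z = J%:Z by lia.
rewrite e3 e1 in e.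
pose p := `|(i - N (- J%:Z))%R|%N.
have ep : i = N (- J%:Z) + p%:Z by rewrite /p /J in hn1 hn2 e e2 *; lia.
have sr : (2 * size r < size (seg omf (N (- J%:Z)) n))%N by rewrite size_seg /J in hn *; lia.
case: (weq_conj_pos W rr sr) => -[a ra E].
  have hp : (p + size a < n)%N.
    have : size r = size a by rewrite ra size_map.
    by rewrite /J in hn1 hn2 e e2 ep hn *; lia.
  have := congr1 (fun x => nth 0%N x (size a + p)) E.
  rewrite /= nth_cat size_seg addnC hp nth_cat ltnNge leq_addl /= addnK.
  rewrite !nth_seg //; last by lia.
  rewrite ra expsum_pos => E'; rewrite ep -E'.
  by congr omf; lia.
have hp : (size a <= p)%N /\ (p < n)%N.
  have : size r = size a by rewrite ra /winv size_rev !size_map.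
  by rewrite /J in hn1 hn2 e e2 ep hn *; lia.
have := congr1 (fun x => nth 0%N x p) E.
rewrite /= nth_cat ltnNge (proj1 hp) /= nth_cat size_seg (proj2 hp).
rewrite !nth_seg //; try lia.
rewrite ra expsum_winv => E'; rewrite ep -E'.
by congr omf; lia.
Qed.

End BiinfiniteWords.

(** * The phase difference between two conjugate maps *)

Section Displacement.
Variable R : realType.
Implicit Types (z : R * R) (s t : R) (k m n : nat).

Lemma int_dist0 s t (j : int) : t = s + j%:~R -> `|t - s| < 1 -> t = s.
Proof.
move=> ->; rewrite addrC addKr -intr_norm -[1](mulr1z 1) ltr_int => h.
have -> : j = 0 by lia.
by rewrite mulr0z addr0.
Qed.

(** The image itineraries under [f] and [g] differ by the shift [A = expsum r], so raising the lift
    of [g] by [A] lets both lifts run over one itinerary. Their difference depends only on the point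
    of the wedge, since both gain the same integer on each circle. The condition on closed sets
    expresses continuity of [D] on the wedge. *)
Lemma conj_displacement m n (f g : R * R -> R * R) :
  positive_map m n f -> positive_map m n g ->
  (exists a : R -> R * R, loop n a /\
     forall gam : R -> R * R, loop m gam ->
       loop_homotopic n (g \o gam) (pcat (path_rev a) (pcat (f \o gam) a))) ->
  exists D : R * R -> R,
    (forall C, closed C -> closed (wedge m `&` D @^-1` C)) /\
    forall om : int -> nat, (forall j, (om j < m)%N) ->
    exists (lf lg : R -> R) (w : int -> nat),
      [/\ continuous lf, [/\ continuous lg, incr lg & forall v, exists s, lg s = v],
          forall s, f (cp om s) = cp w (lf s), forall s, g (cp om s) = cp w (lg s) &
          forall s, D (cp om s) = lg s - lf s].
Proof.
move=> pf pg ha.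
have [[_ _ fw _] [_ _ gw _]] := (pf, pg).
have HX h (ph : positive_map m n h) k : exists x : (R -> R) * (int -> nat) * nat,
   (k < m)%N -> [/\ line n (h \o circle_pt k) x.1.1 x.1.2,
     x.1.1 0 = 0, x.1.1 1 = x.2%:R & (0 < x.2)%N].
  have [km|nkm] := boolP (k < m)%N; last by exists (id, fun=> 0%N, 0%N).
  by have [mu [w [l h']]] := positive_map_circle ph km; exists (mu, w, l).
have [xf Hf] := choice (HX f pf); have [xg Hg] := choice (HX g pg).
have [r rr Hr] := conj_words fw Hf Hg ha.
have lfg k : (k < m)%N -> (xf k).2 = (xg k).2.
  by move/Hr/weq_size; rewrite /word !size_mkseq.
pose A := expsum r.
pose Dk k s := A%:~R + (xg k).1.1 s - (xf k).1.1 s.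
have cDk k : (k < m)%N -> continuous (Dk k).
  move=> km t; have [[cf _ _ _] _ _ _] := Hf k km; have [[cg _ _ _] _ _ _] := Hg k km.
  by apply: cvgB; [apply: cvgD; [exact: cvg_cst|exact: cg]|exact: cf].
have Dk0 k : (k < m)%N -> Dk k 0 = A%:~R.
  move=> km; rewrite /Dk; have [_ -> _ _] := Hf k km; have [_ -> _ _] := Hg k km.
  by rewrite subr0 addr0.
have Dk1 k : (k < m)%N -> Dk k 1 = A%:~R.
  move=> km; have [_ _ hf _] := Hf k km; have [_ _ hg _] := Hg k km.
  by rewrite /Dk hf hg (lfg k km) addrK.
(* The value does not depend on the pair [(k, s)] representing [z], because every [Dk k] equals [A]
   at both ends; off the wedge the default is 0. *)
have HD z : exists d, forall k s, (k < m)%N -> 0 <= s -> s <= 1 -> z = circle_pt k s ->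
    d = Dk k s.
  have [[k0 [s0 [km0 s00 s01 e0]]]|no] := pselect (exists k0 s0,
      [/\ (k0 < m)%N, 0 <= s0, s0 <= 1 & z = circle_pt k0 s0]); last first.
    by exists 0 => k s km s0 s1 e; exfalso; apply: no; exists k, s.
  exists (Dk k0 s0) => k s km s0' s1 e.
  have E : circle_pt k0 s0 = circle_pt k s by rewrite -e0.
  have W k' t : (k' < m)%N -> 0 <= t -> t <= 1 -> circle_pt k' t = wedge_pt R ->
      Dk k' t = A%:~R.
    move=> km' t0 t1 /circle_pt_wedge[j ej].
    have : 0 <= j <= 1 by rewrite -(ler0z R) -[_ <= 1](lerz1 R) -ej t0 t1.
    move=> /andP[j0 j1]; have [->|->] : t = 0 \/ t = 1; [|exact: Dk0|exact: Dk1].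
    have [j00|j11] : j = 0 \/ j = 1 by lia.
      by left; rewrite ej j00.
    by right; rewrite ej j11.
  have [hw|hw] := pselect (circle_pt k0 s0 = wedge_pt R).
    by rewrite !W // -E.
  have kk := circle_pt_inj E hw; subst k0; congr (Dk k _).
  have [j ej] := circle_pt_phase E.
  symmetry; apply: (int_dist0 ej).
  have ne x : x = 0 \/ x = 1 -> circle_pt k x = wedge_pt R.
    by case=> ->; [exact: circle_pt0|exact: (@circle_ptz R k 1)].
  have n1 : s0 <> 0 by move=> h; apply: hw; apply: ne; left.
  have n2 : s0 <> 1 by move=> h; apply: hw; apply: ne; right.
  have p1 : 0 < s0 by rewrite lt_neqAle s00 andbT eq_sym; apply/eqP.
  have p2 : s0 < 1 by rewrite lt_neqAle s01 andbT; apply/eqP.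
  by rewrite ltr_norml; lra.
have [D HD'] := choice HD.
exists D; split=> [C cC|om omm].
  have -> : wedge m `&` D @^-1` C =
      \bigcup_(k in `I_m) (@circle_pt R k @` (`[0, 1] `&` Dk k @^-1` C)).
    apply/seteqP; split=> z /=.
      move=> [[k [t [km ez]]]] Dz; exists k => //=.
      exists (t - (Num.floor t)%:~R); last by rewrite -mulrNz circle_ptDz.
      have ht : 0 <= t - (Num.floor t)%:~R <= 1.
        by have := floor_itv t; rewrite intrD mulr1z; lra.
      split; first exact: ht.
      have /andP[h1 h2] := ht.
      rewrite -(HD' z k _ km h1 h2) // -mulrNz circle_ptDz //.
    move=> [k km [t [/andP[t0 t1] Dt] ez]].
    split; first by exists k, t.
    by rewrite (HD' z k t).
  apply: closed_bigcup; first exact: finite_II.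
  move=> k km; apply: compact_closed; first exact: norm_hausdorff.
  apply: continuous_compact; first by apply: continuous_subspaceT; exact: circle_pt_continuous.
  apply: compact_closedI; first exact: segment_compact.
  by apply: closed_comp => // t _; exact: cDk.
have base h (ph : positive_map m n h) : exists lam w, line n (fun t => h (cp om t)) lam w /\ lam 0 = 0.
  have [lam [w L]] := positive_map_line ph omm.
  apply: (line_normalize L).
  by have [_ _ hw _] := ph; rewrite -hw (@cpz R om 0).
have [lf [wf [Lf lf0]]] := base f pf.
have [lg [wg [Lg lg0]]] := base g pg.
have segf j := @line_segment R n f om lf (xf (om j)).1.1 wf (xf (om j)).1.2 (xf (om j)).2 j.
have segg j := @line_segment R n g om lg (xg (om j)).1.1 wg (xg (om j)).1.2 (xg (om j)).2 j.
pose N j := Num.floor (lf j%:~R).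
have lfN j : lf j%:~R = (N j)%:~R.
  have [i ei] : exists i : int, lf j%:~R = i%:~R.
    apply: (@circle_pt_wedge R (wf (Num.floor (lf j%:~R)))).
    by case: Lf => _ _ _ E; rewrite -[LHS]E cpz.
  by rewrite /N ei intrKfloor.
have step_f j : N (j + 1) = N j + ((xf (om j)).2)%:Z.
  have [Lk k0 k1 _] := Hf _ (omm j).
  have [+ _] := segf j (N j) Lf Lk k0 k1 (lfN j).
  move=> /(_ 1 ler01 (lexx _)); rewrite k1.
  rewrite -[j%:~R + 1]/(j%:~R + 1%:~R) -intrD lfN => e.
  by apply: (@intr_inj R); rewrite e intrD.
have step_g j : lg j%:~R = (N j)%:~R -> lg (j + 1)%:~R = (N (j + 1))%:~R.
  move=> h; have [Lk k0 k1 _] := Hg _ (omm j).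
  have [+ _] := segg j (N j) Lg Lk k0 k1 h.
  move=> /(_ 1 ler01 (lexx _)); rewrite k1.
  by rewrite step_f lfg // !intrD => <-.
(* Image words of equal length give both lifts the same block boundaries. For negative [j] the
   recursion is solved backwards, which requires knowing that the lift is an integer there. *)
have lgN j : lg j%:~R = (N j)%:~R.
  have N0 : N 0 = 0 by rewrite /N lf0 floor0.
  elim/int_rect: j => [|j IH|j IH]; first by rewrite lg0 N0.
    by rewrite -addn1 PoszD; exact: step_g.
  have ej : - j%:Z = - (j.+1)%:Z + 1 by lia.
  have [i ei] : exists i : int, lg (- (j.+1)%:Z)%:~R = i%:~R.
    apply: (@circle_pt_wedge R (wg (Num.floor (lg (- (j.+1)%:Z)%:~R)))).
    by case: Lg => _ _ _ E; rewrite -[LHS]E cpz.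
  set j1 := - (j.+1)%:Z in ej ei *.
  have [Lk k0 k1 _] := Hg _ (omm j1).
  have [+ _] := segg j1 i Lg Lk k0 k1 ei.
  move=> /(_ 1 ler01 (lexx _)); rewrite k1 -[j1%:~R + 1]/(j1%:~R + 1%:~R) -intrD -ej IH.
  by rewrite ej step_f lfg // ei intrD => /addIr ->.
have wfg : forall i, wg i = wf (i + A).
  apply: (@conj_biinfinite m om N (fun k => (xf k).1.2) (fun k => (xg k).1.2)
     (fun k => (xf k).2)) => //.
  - by rewrite /N lf0 floor0.
  - by move=> k km; have [_ _ _] := Hf k km.
  - move=> j i hi; have [Lk k0 k1 _] := Hf _ (omm j).
    by have [_ ->] := segf j (N j) Lf Lk k0 k1 (lfN j).
  - move=> j i hi; have [Lk k0 k1 _] := Hg _ (omm j).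
    by have [_ -> //] := segg j (N j) Lg Lk k0 k1 (lgN j); rewrite -lfg.
  - by move=> k km; rewrite {2}lfg //; exact: Hr.
case: (Lf) => cf i_f nf ef; case: (Lg) => cg ig ng eg.
exists lf, (fun s => lg s + A%:~R), wf; split=> //.
- split.
  + by move=> t; apply: cvgD; [exact: cg|exact: cvg_cst].
  + by move=> s t st; rewrite ltrD2r; exact: ig.
  + move=> v.
    (* Every image word is nonempty, so the lift gains at least 1 per circle. *)
    have grow (J : nat) : J%:R <= lg J%:R /\ lg (- J%:R) <= - J%:R.
      have gap j : lg (j + 1)%:~R >= lg j%:~R + 1.
        rewrite !lgN step_f intrD lerD2l -[1](mulr1z 1) ler_int lez_nat.
        by have [_ _ _] := Hf _ (omm j).
      elim: J => [|J [IH1 IH2]]; first by rewrite oppr0 lg0.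
      have h1 := gap J%:Z; have h2 := gap (- (J.+1)%:Z).
      have e1 : (J%:Z + 1)%:~R = J.+1%:R :> R by rewrite intrD -natr1.
      have e2 : (- (J.+1)%:Z + 1)%:~R = - J%:R :> R.
        by rewrite intrD mulrNz -[(J.+1)%:Z%:~R]natr1 opprD addrNK.
      rewrite e1 in h1; rewrite e2 mulrNz in h2.
      have S : J.+1%:R = J%:R + 1 :> R by rewrite natr1.
      split; first by rewrite {1}S; apply: le_trans h1; rewrite lerD2r.
      rewrite [X in _ <= - X]S opprD lerBrDr; exact: le_trans h2 IH2.
    pose J := (Num.truncn `|v - A%:~R|).+1.
    have hJ := truncnS_gt `|v - A%:~R|; rewrite -/J in hJ.
    have [g1 g2] := grow J; move: hJ; rewrite ltr_norml => /andP[hJ1 hJ2].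
    have [||c ec] := @IVT_any R lg (- J%:R) J%:R (v - A%:~R) cg; [lra|lra|].
    by exists c; rewrite ec subrK.
- by move=> s; rewrite eg cp_shift /cp wfg.
- move=> s; pose j := Num.floor s; pose t := s - j%:~R.
  have ht : 0 <= t <= 1 by have := floor_itv s; rewrite /t intrD mulr1z -/j; lra.
  have /andP[t0 t1] := ht.
  have es : cp om s = circle_pt (om j) t by rewrite /cp -/j /t -mulrNz circle_ptDz.
  rewrite (HD' _ _ t (omm j) t0 t1 es).
  have [Lk k0 k1 _] := Hf _ (omm j).
  have [+ _] := segf j (N j) Lf Lk k0 k1 (lfN j).
  have [Lk' k0' k1' _] := Hg _ (omm j).
  have [+ _] := segg j (N j) Lg Lk' k0' k1' (lgN j).
  move=> /(_ t t0 t1) + /(_ t t0 t1).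
  by rewrite /t addrC subrK -/t => -> ->; rewrite /Dk; ring.
Qed.

End Displacement.

(** * Displacement along a flow *)

Section Implicit.
Variables (R : realType) (T : topologicalType).
Implicit Types (F : T -> R -> R) (u : T -> R).

Lemma continuous_gt (c : T -> R) (x : T) (v : R) : continuous c -> v < c x ->
  \forall y \near x, v < c y.
Proof.
move=> cc h; have e0 : 0 < c x - v by rewrite subr_gt0.
have /cvgrPdist_lt/(_ _ e0) := cc x; apply: filterS => y.
by rewrite ltr_norml; lra.
Qed.

Lemma continuous_lt (c : T -> R) (x : T) (v : R) : continuous c -> c x < v ->
  \forall y \near x, c y < v.
Proof.
move=> cc h; have e0 : 0 < v - c x by rewrite subr_gt0.
have /cvgrPdist_lt/(_ _ e0) := cc x; apply: filterS => y.
by rewrite ltr_norml; lra.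
Qed.

(** Monotonicity traps [u y] between [u x - e] and [u x + e] as soon as two strict inequalities at
    these fixed times persist near [x]. *)
Lemma implicit_continuous F u : (forall t, continuous (fun x => F x t)) ->
  (forall x, incr (F x)) -> continuous (fun x => F x (u x)) -> continuous u.
Proof.
move=> cF iF cc x; apply/cvgrPdist_lt => e e0.
have c1 : continuous (fun y => F y (u x - e) - F y (u y)).
  by move=> y; apply: cvgB; [exact: cF|exact: cc].
have c2 : continuous (fun y => F y (u x + e) - F y (u y)).
  by move=> y; apply: cvgB; [exact: cF|exact: cc].
near=> y.
have h1 : F y (u x - e) - F y (u y) < 0.
  by near: y; apply: continuous_lt c1 _; rewrite subr_lt0; apply: iF; lra.
have h2 : 0 < F y (u x + e) - F y (u y).
  by near: y; apply: continuous_gt c2 _; rewrite subr_gt0; apply: iF; lra.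
move: h1 h2; rewrite subr_lt0 subr_gt0 !(incr_lt _ _ (iF y)) ltr_norml; lra.
Unshelve. all: end_near. Qed.

(** Separate continuity suffices because the values of the monotone [F y] at two fixed times enclose
    [F y (u y)]. *)
Lemma joint_continuous F u : (forall t, continuous (fun x => F x t)) ->
  (forall x, incr (F x)) -> (forall x, continuous (F x)) -> continuous u ->
  continuous (fun x => F x (u x)).
Proof.
move=> cF iF cFx cu x; apply/cvgrPdist_lt => e e0.
have [d d0 hd] : exists2 d, 0 < d & forall t, `|t - u x| < d -> `|F x (u x) - F x t| < e / 2.
  apply: nearR; move/cvgrPdist_lt: (cFx x (u x)); apply; lra.
near=> y.
have h1 : `|F x (u x - d / 2) - F y (u x - d / 2)| < e / 2.
  by near: y; move/cvgrPdist_lt: (cF (u x - d / 2) x); apply; lra.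
have h2 : `|F x (u x + d / 2) - F y (u x + d / 2)| < e / 2.
  by near: y; move/cvgrPdist_lt: (cF (u x + d / 2) x); apply; lra.
have h3 : `|u x - u y| < d / 2.
  by near: y; move/cvgrPdist_lt: (cu x); apply; lra.
have h4 := hd (u x - d / 2); have h5 := hd (u x + d / 2).
have {}h4 : `|F x (u x) - F x (u x - d / 2)| < e / 2.
  by apply: h4; rewrite ltr_norml; lra.
have {}h5 : `|F x (u x) - F x (u x + d / 2)| < e / 2.
  by apply: h5; rewrite ltr_norml; lra.
move: h3; rewrite ltr_norml => /andP[h3 h3'].
have h6 : F y (u x - d / 2) < F y (u y) by apply: iF; lra.
have h7 : F y (u y) < F y (u x + d / 2) by apply: iF; lra.
by move: h1 h2 h4 h5; rewrite !ltr_norml; lra.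
Unshelve. all: end_near. Qed.

End Implicit.

Section SmallIntegers.
Variable R : realType.

Lemma int_lt1_gt0 (i : int) : i%:~R < 1 :> R -> 0 < i%:~R :> R -> False.
Proof. by rewrite -[1](mulr1z 1) ltr_int ltr0z; lia. Qed.

Lemma int_small_eq0 (i : int) : i%:~R < 1 :> R -> - 1 < i%:~R :> R -> i = 0.
Proof.
rewrite -[X in _ < X -> _](mulr1z 1) -mulrN1z !ltr_int; lia.
Qed.

End SmallIntegers.

Section Phase.
Variable R : realType.
Implicit Types (s t : R) (k n : nat).

Lemma phase_nbhs n (s0 e : R) : 0 < e -> e <= 2^-1 ->
  exists V : set (R * R), open V /\ forall k s, (k < n)%N ->
    V (circle_pt k s) <-> exists m : int, `|s - s0 - m%:~R| < e.
Proof.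
move=> e0 e1; pose B := \bigcup_(k in `I_n) (@circle_pt R k @` `[s0 + e, s0 + 1 - e]).
exists (~` B); split.
  apply: closed_openC; apply: closed_bigcup; first exact: finite_II.
  move=> k km; apply: compact_closed; first exact: norm_hausdorff.
  apply: continuous_compact; first by apply: continuous_subspaceT; exact: circle_pt_continuous.
  exact: segment_compact.
move=> k s kn; split.
  move=> nB; apply: contrapT => no; apply: nB; exists k => //.
  have := floor_itv (s - s0); set m := Num.floor _; rewrite intrD mulr1z => hm.
  exists (s - m%:~R); last by rewrite -mulrNz circle_ptDz.
  rewrite /= in_itv /=; apply/andP; split; rewrite leNgt; apply/negP => h; apply: no.
    by exists m; rewrite ltr_norml; lra.
  by exists (m + 1); rewrite ltr_norml intrD mulr1z; lra.
move=> [m hm] [k' _ [t]]; rewrite /= in_itv /= => /andP[t1 t2] /circle_pt_phase[j ej].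
move: hm; rewrite ej ltr_norml => /andP[h1 h2].
have h3 : ((m - j)%:~R : R) < 1 by rewrite intrB; lra.
have h4 : 0 < ((m - j)%:~R : R) by rewrite intrB; lra.
exact: int_lt1_gt0 h3 h4.
Qed.

End Phase.

Section FlowDisplacement.
Variables (R : realType) (X : topologicalType) (phi : R -> X -> X).
Hypothesis cX : compact [set: X].
Hypothesis flow : is_flow phi.

Lemma flow_continuous (T : topologicalType) (u : T -> R) (v : T -> X) :
  continuous u -> continuous v -> continuous (fun y => phi (u y) (v y)).
Proof.
case: flow => cf _ cu cv y.
by apply: (@continuous_comp _ _ _ (fun y => (u y, v y)) (fun q : R * X => phi q.1 q.2));
  [exact: continuous_pair|exact: cf].
Qed.

(** The lifts are chosen independently for each [x], so only increments can be continuous. On a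
    short time interval all phases near [x0] stay within 1/8 of one value modulo integers, so
    increments are below 1/4, and the integer offsets at the two ends must coincide. *)
Lemma lift_diff_continuous n (P : X -> R * R) (lam : X -> R -> R) (w : X -> int -> nat) :
  continuous P -> (forall x, line n (fun t => P (phi t x)) (lam x) (w x)) ->
  forall t, continuous (fun x => lam x t - lam x 0).
Proof.
move=> cP L.
have E x t : P (phi t x) = circle_pt (w x (Num.floor (lam x t))) (lam x t).
  by case: (L x) => _ _ _ ->.
have wn x j : (w x j < n)%N by case: (L x).
suff main x0 a b : a <= b -> {for x0, continuous (fun x => lam x b - lam x a)}.
  move=> t x; have [t0|/ltW t0] := leP 0 t; first exact: main.
  have -> : (fun x => lam x t - lam x 0) = (fun x => - (lam x 0 - lam x t)).
    by apply/funext => y; rewrite opprB.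
  by apply: cvgN; exact: main.
apply: (@cousin R (fun a b => {for x0, continuous (fun x => lam x b - lam x a)})) => [{}a {}b c _ _ cab cbc|t0].
  have -> : (fun x => lam x c - lam x a) =
            (fun x => (lam x c - lam x b) + (lam x b - lam x a)).
    by apply/funext => y; ring.
  by apply: cvgD; [exact: cbc|exact: cab].
suff [d d0 hd] : exists2 d, 0 < d & forall a b, a <= b -> t0 - d < a -> b < t0 + d ->
    {for x0, continuous (fun x => lam x b - lam x a)}.
  by exists d => //; split=> [c c1 c2|c c1 c2]; apply: hd => //; lra.
have e8 : 8^-1 <= 2^-1 :> R by lra.
have e8p : 0 < 8^-1 :> R by lra.
have [V [oV hV]] := @phase_nbhs R n (lam x0 t0) 8^-1 e8p e8.
have cPp : continuous (fun q : R * X => P (phi q.1 q.2)).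
  move=> q; apply: (@continuous_comp _ _ _ (fun q : R * X => phi q.1 q.2) P); last exact: cP.
  by case: flow => cf _; exact: cf.
have : nbhs (t0, x0) ((fun q : R * X => P (phi q.1 q.2)) @^-1` V).
  apply: cPp; apply: open_nbhs_nbhs; split=> //=.
  by rewrite E; apply/hV => //; exists 0; rewrite subrr subr0 normr0; lra.
move=> [[A B] /= [/nearR[d d0 hd] nB] hAB].
exists d => // {}a {}b ab ad bd.
have phase_near x t : B x -> a <= t -> t <= b ->
    exists m : int, `|lam x t - lam x0 t0 - m%:~R| < 8^-1.
  move=> Bx ta tb; apply/(hV (w x (Num.floor (lam x t)))) => //; rewrite -E.
  by apply: (hAB (t, x)); split=> //=; apply: hd; rewrite ltr_norml; lra.
have small x : B x -> 0 <= lam x b - lam x a < 4^-1.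
  move=> Bx; have [cl il _ _] := L x.
  rewrite subr_ge0 (incr_le _ _ il) ab /=.
  have [m hm] := phase_near x a Bx (lexx _) ab.
  rewrite ltNge; apply/negP => big; move: hm; rewrite ltr_norml => hm.
  have [||c [c1 c2 ec]] := @IVT_le R (lam x) a b (lam x0 t0 + m%:~R + 8^-1) cl ab; [lra|lra|].
  have [m' ] := phase_near x c Bx c1 c2; rewrite ec ltr_norml => /andP[h1 h2].
  have h3 : ((m' - m)%:~R : R) < 1 by rewrite intrB; lra.
  have h4 : 0 < ((m' - m)%:~R : R) by rewrite intrB; lra.
  exact: int_lt1_gt0 h3 h4.
apply/cvgrPdist_lt => e e0.
pose e' := Num.min (e / 2) 16^-1.
have e'0 : 0 < e' by rewrite lt_min; lra.
have [e'1 e'2] : e' <= e / 2 /\ e' <= 16^-1 by rewrite /e' !ge_min !lexx orbT.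
have e'h : e' <= 2^-1 by lra.
have nearO t : \forall x \near x0, exists m : int, `|lam x t - lam x0 t - m%:~R| < e'.
  have [Ot [oOt hOt]] := @phase_nbhs R n (lam x0 t) e' e'0 e'h.
  have : nbhs x0 ((fun x => P (phi t x)) @^-1` Ot).
    have cc : continuous (fun x => P (phi t x)).
      move=> x; apply: (@continuous_comp _ _ _ (phi t) P); last exact: cP.
      by apply: (flow_continuous (u := fun=> t)) => ?; [exact: cvg_cst|exact: cvg_id].
    apply: cc; apply: open_nbhs_nbhs; split=> //=.
    by rewrite E; apply/hOt => //; exists 0; rewrite subrr subr0 normr0; lra.
  by apply: filterS => x /=; rewrite E => /hOt; apply.
near=> x.
have Bx : B x by near: x.
have Bx0 : B x0 by exact: nbhs_singleton.
have [ma] : exists m : int, `|lam x a - lam x0 a - m%:~R| < e' by near: x; exact: nearO.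
have [mb] : exists m : int, `|lam x b - lam x0 b - m%:~R| < e' by near: x; exact: nearO.
have := small x Bx; have := small x0 Bx0.
rewrite !ltr_norml => s1 s2 h1 h2.
have i0 : mb - ma = 0.
  have h3 : ((mb - ma)%:~R : R) < 1 by rewrite intrB; lra.
  have h4 : -1 < ((mb - ma)%:~R : R) by rewrite intrB; lra.
  exact: int_small_eq0 h3 h4.
have : (mb%:~R : R) = ma%:~R by move/subr0_eq: i0 => ->.
by lra.
Unshelve. all: end_near. Qed.

Lemma projection_displacement n (P : X -> R * R) : projection phi n P ->
  exists L : X -> R -> R,
    [/\ forall x, continuous (L x) /\ incr (L x),
        forall x s t, L x (s + t) = L x t + L (phi t x) s,
        forall t, continuous (fun x => L x t),
        forall x v, exists t, L x t = v &
        forall x, exists (c : R) (w : int -> nat), (forall j, (w j < n)%N) /\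
          forall t, P (phi t x) = cp w (L x t + c)].
Proof.
move=> [cP _ pP]; have [_ [phi0 phiD]] := flow.
have H x : exists lw : (R -> R) * (int -> nat), line n (fun t => P (phi t x)) lw.1 lw.2.
  by have [lam [w h]] := positive_curve_line (pP x); exists (lam, w).
have [lw Llw] := choice H.
pose L x t := (lw x).1 t - (lw x).1 0.
have cL x : continuous (L x).
  by move=> t; apply: cvgB; [case: (Llw x) => h _ _ _; exact: h|exact: cvg_cst].
have iL x : incr (L x).
  by move=> s t st; rewrite ltrD2r; case: (Llw x) => _ h _ _; exact: h.
have DL x s t : L x (s + t) = L x t + L (phi t x) s.
  have [cl il wn e] := Llw x.
  have S : line n (fun s => P (phi s (phi t x))) (fun s => (lw x).1 (s + t)) (lw x).2.
    split=> //.
    - move=> r; apply: (@continuous_comp _ _ _ (fun s => s + t) (lw x).1); last exact: cl.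
      by apply: cvgD; [exact: cvg_id|exact: cvg_cst].
    - by move=> r r' rr'; apply: il; rewrite ltrD2r.
    - by move=> r; rewrite -phiD e.
  have [m hm] := line_unique S (Llw (phi t x)).
  by rewrite /L !hm add0r; ring.
have ccL t : continuous (fun x => L x t).
  exact: (@lift_diff_continuous n P (fun x => (lw x).1) (fun x => (lw x).2)).
have L0 x : L x 0 = 0 by rewrite /L subrr.
(* By compactness the phase gained in unit time is bounded below uniformly, so increments are
   unbounded in both directions. *)
have [k hk] : exists k : nat, forall x, k.+1%:R^-1 < L x 1.
  have /compact_near_coveringP cov := cX.
  have [k _ hk] : \forall k \near \oo, [set: X] `<=` (fun x => k.+1%:R^-1 < L x 1).
    apply: (cov nat \oo (fun k x => k.+1%:R^-1 < L x 1) _) => x _.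
    have Lx : 0 < L x 1 by rewrite -(L0 x); exact: iL.
    exists ([set y | L x 1 / 2 < L y 1], [set k : nat | k.+1%:R^-1 < L x 1 / 2]).
      split; first by apply: continuous_gt (ccL 1) _; lra.
      have e0 : 0 < L x 1 / 2 by lra.
      exact: (near_infty_natSinv_lt (PosNum e0)).
    by move=> [y j] /= [h1 h2]; exact: lt_trans h1.
  by exists k => x; apply: (hk k (leqnn _)).
have grow (j : nat) x : j%:R * k.+1%:R^-1 <= L x j%:R.
  elim: j x => [|j IH] x; first by rewrite mul0r L0.
  by rewrite -natr1 addrC DL mulrDl mul1r addrC lerD // ltW.
have shrink (j : nat) x : L x (- j%:R) <= - (j%:R * k.+1%:R^-1).
  have := DL x j%:R (- j%:R); rewrite subrr L0.
  move=> e; rewrite lerNr.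
  have -> : - L x (- j%:R) = L (phi (- j%:R) x) j%:R; last exact: grow.
  by apply: (addrI (L x (- j%:R))); rewrite subrr.
exists L; split=> //.
- move=> x v; pose j := (Num.truncn (`|v| * k.+1%:R)).+1.
  have hj : `|v| < j%:R * k.+1%:R^-1.
    by rewrite ltr_pdivlMr //; exact: truncnS_gt.
  have := grow j x; have := shrink j x; move: hj; rewrite ltr_norml => /andP[h1 h2] g1 g2.
  apply: (@IVT_any R (L x) (- j%:R) j%:R v (cL x)).
    exact: ltW (le_lt_trans g1 h1).
  exact: ltW (lt_le_trans h2 g2).
- move=> x; exists ((lw x).1 0), (lw x).2; have [_ _ wn e] := Llw x; split=> // t.
  by rewrite e subrK.
Qed.

End FlowDisplacement.

(** * Finite fibres and continuity of composites and inverses *)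

Section Topology.
Variable R : realType.

Lemma finite_range_constant (gam : R -> R * R) (S : set (R * R)) :
  continuous gam -> finite_set S -> (forall t, S (gam t)) -> forall a b, gam a = gam b.
Proof.
move=> cg fS hS; apply: cousin_const => t.
have cl : closed (S `\ gam t).
  have /hausdorff_accessible/accessible_finite_set_closed : hausdorff_space (R * R)%type.
    exact: norm_hausdorff.
  by apply; apply: sub_finite_set fS; exact: subDsetl.
have : nbhs t (gam @^-1` ~` (S `\ gam t)).
  apply: cg; apply: open_nbhs_nbhs; split; first exact: closed_openC.
  by move=> [_]; apply.
move/nearR => [d d0 hd]; exists d => // s st.
by apply: contrapT => ne; apply: (hd s st); split.
Qed.

(** On one circle the lift of [g] increases strictly and gains [l]. Lifted phases of points with
    equal image differ by integers of absolute value at most [l], and each phase is attained only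
    once. *)
Lemma positive_map_fiber m n (g : R * R -> R * R) z : positive_map m n g ->
  finite_set (wedge m `&` g @^-1` [set z]).
Proof.
move=> pg.
pose I k := [set s : R | [/\ 0 <= s, s <= 1 & g (circle_pt k s) = z]].
apply: (@sub_finite_set _ _ (\bigcup_(k in `I_m) (@circle_pt R k @` I k))).
  move=> _ [[k [t [km ->]]] gz]; exists k => //.
  exists (t - (Num.floor t)%:~R); last by rewrite -mulrNz circle_ptDz.
  have := floor_itv t; rewrite intrD mulr1z => /andP[h1 h2].
  by split; [lra|lra|rewrite -mulrNz circle_ptDz].
apply: bigcup_finite; first exact: finite_II.
move=> k km; apply: finite_image.
have [[s0 [s00 s01 e0]]|no] := pselect (exists s, I k s); last first.
  rewrite (_ : I k = set0) //; apply/seteqP; split=> // s Is.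
  by case: no; exists s.
have [mu [w [l [[_ il _ e] mu0 mu1 _]]]] := positive_map_circle pg km.
have HG (i : nat) : exists s, (exists s', mu s' = mu s0 - l.+1%:R + i%:R) ->
    mu s = mu s0 - l.+1%:R + i%:R.
  have [[s h]|no] := pselect (exists s', mu s' = mu s0 - l.+1%:R + i%:R).
    by exists s.
  by exists 0.
have [G hG] := choice HG.
apply: (@sub_finite_set _ _ (G @` `I_(2 * l.+1))); last exact: finite_image.
move=> s [h0 h1 es].
have : cp w (mu s0) = cp w (mu s) by rewrite -e -[RHS]e /= e0 es.
move=> /cp_phase[j ej].
have b t : 0 <= t -> t <= 1 -> 0 <= mu t /\ mu t <= l%:R.
  by move=> t0 t1; rewrite -mu0 -mu1 !incr_le.
have [b1 b2] := b s h0 h1; have [b3 b4] := b s0 s00 s01.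
have l1 : l.+1%:R = l%:R + 1 :> R by rewrite natr1.
have j1 : (- (l.+1)%:Z < j)%R.
  by rewrite -(ltr_int R) mulrNz -[(l.+1)%:Z%:~R]/(l.+1%:R) l1; lra.
have j2 : (j < (l.+1)%:Z)%R.
  by rewrite -(ltr_int R) -[(l.+1)%:Z%:~R]/(l.+1%:R) l1; lra.
pose i := `|(j + (l.+1)%:Z)%R|%N.
have ei : i%:Z = j + (l.+1)%:Z by rewrite /i; lia.
have eiR : i%:R = j%:~R + l.+1%:R :> R by rewrite -[i%:R]/(i%:Z%:~R) ei intrD.
have ms : mu s = mu s0 - l.+1%:R + i%:R by rewrite eiR ej; ring.
exists i; first by rewrite /=; lia.
by apply: (incr_inj il); rewrite ms; apply: hG; exists s.
Qed.

Lemma continuous_of_closed_wedge (X : topologicalType) m (P : X -> R * R) (D : R * R -> R) :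
  (forall C, closed C -> closed (wedge m `&` D @^-1` C)) ->
  continuous P -> (forall x, wedge m (P x)) -> continuous (D \o P).
Proof.
move=> hD cP wP; apply/continuous_closedP => C cC.
have -> : (D \o P) @^-1` C = P @^-1` (wedge m `&` D @^-1` C).
  by apply/seteqP; split=> x /=; [split=> //; exact: wP|case].
by apply: closed_comp; [move=> x _; exact: cP|exact: hD].
Qed.

Lemma compact_inverse_continuous (X Y : topologicalType) (h : X -> Y) (h' : Y -> X) :
  compact [set: X] -> hausdorff_space Y -> continuous h -> cancel h h' -> cancel h' h ->
  continuous h'.
Proof.
move=> cX hY ch hK h'K; apply/continuous_closedP => C cC.
have -> : h' @^-1` C = h @` C.
  apply/seteqP; split=> [y Cy|_ [x Cx <-]]; last by rewrite /= hK.
  by exists (h' y) => //; rewrite h'K.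
apply: compact_closed => //; apply: continuous_compact.
  exact: continuous_subspaceT.
exact: subclosed_compact cC cX _.
Qed.

End Topology.

(** * Comparing two consecutive levels along an orbit *)

Section LevelStep.
Variables (R : realType) (X : topologicalType) (phi : R -> X -> X).
Hypothesis flow : is_flow phi.

(** [L x t] is the phase gained when [x] flows for time [t]. Unlike the phase itself it involves no
    choice of an integer; that choice is absorbed by [c]. *)
Definition displacement n (P : X -> R * R) (L : X -> R -> R) :=
  [/\ forall x, continuous (L x) /\ incr (L x),
      forall x s t, L x (s + t) = L x t + L (phi t x) s,
      forall t, continuous (fun x => L x t),
      forall x v, exists t, L x t = v &
      forall x, exists (c : R) (w : int -> nat), (forall j, (w j < n)%N) /\
        forall t, P (phi t x) = cp w (L x t + c)].

Lemma displacement0 n P L x : displacement n P L -> L x 0 = 0.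
Proof.
move=> [_ D _ _ _]; have := D x 0 0; case: flow => _ [-> _]; rewrite addr0 => e.
by apply: (addrI (L x 0)); rewrite -e addr0.
Qed.

(** Along an orbit the lift of [f] is [L0 x] plus a constant [K], so [F] is the lift of [g] minus
    [K]. This makes [F] increasing and onto, although [D] itself need not be monotone, and
    [F t = L0 x t'] says that both lifts reach the same phase on a common itinerary. *)
Lemma shifted_displacement m n (P0 P1 : X -> R * R) (L0 L1 : X -> R -> R)
    (f g : R * R -> R * R) (D : R * R -> R) :
  displacement n P0 L0 -> displacement m P1 L1 -> (forall x, P0 x = f (P1 x)) ->
  (forall om : int -> nat, (forall j, (om j < m)%N) ->
    exists (lf lg : R -> R) (w : int -> nat),
      [/\ continuous lf, [/\ continuous lg, incr lg & forall v, exists s, lg s = v],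
          forall s, f (cp om s) = cp w (lf s), forall s, g (cp om s) = cp w (lg s) &
          forall s, D (cp om s) = lg s - lf s]) ->
  forall x, let F t := L0 x t + D (P1 (phi t x)) in
    [/\ incr F, forall v, exists t, F t = v &
        forall t t', F t = L0 x t' -> g (P1 (phi t x)) = P0 (phi t' x)].
Proof.
move=> [cL0 _ _ _ eL0] [cL1 _ _ oL1 eL1] e01 HD x F.
have [c1 [om [omm e1]]] := eL1 x.
have [lf [lg [w [clf [clg ilg olg] ef eg eD]]]] := HD om omm.
have [c0 [w0 [_ e0]]] := eL0 x.
have [cL0x iL0x] := cL0 x; have [cL1x iL1x] := cL1 x.
have E u : cp w0 (L0 x u + c0) = cp w (lf (L1 x u + c1)).
  by rewrite -e0 e01 e1 ef.
have [K hK] : exists K, forall t, lf (L1 x t + c1) = L0 x t + K.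
  exists (lf (L1 x 0 + c1) - L0 x 0) => t.
  have H a b : a <= b -> lf (L1 x a + c1) - (L0 x a + c0) = lf (L1 x b + c1) - (L0 x b + c0).
    move=> ab; apply: (@phase_unique R (fun u => L0 x u + c0) (fun u => lf (L1 x u + c1)) w0 w).
    - by move=> u; apply: cvgD; [exact: cL0x|exact: cvg_cst].
    - move=> u; apply: (@continuous_comp _ _ _ (fun u => L1 x u + c1) lf); last exact: clf.
      by apply: cvgD; [exact: cL1x|exact: cvg_cst].
    - exact: ab.
    - by move=> u _ _; exact: E.
  have : lf (L1 x t + c1) - (L0 x t + c0) = lf (L1 x 0 + c1) - (L0 x 0 + c0).
    by have [/H|/ltW/H] := leP t 0.
  by lra.
have FE t : F t = lg (L1 x t + c1) - K.
  by rewrite /F e1 eD hK; ring.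
split.
- by move=> s t st; rewrite !FE ltrD2r; apply: ilg; rewrite ltrD2r; exact: iL1x.
- move=> v; have [s es] := olg (v + K); have [t et] := oL1 x (s - c1).
  by exists t; rewrite FE et subrK es addrK.
- move=> t t'; rewrite FE => h; rewrite e1 eg.
  have -> : lg (L1 x t + c1) = lf (L1 x t' + c1) by rewrite hK -h subrK.
  by rewrite -ef -e1 -e01.
Qed.

End LevelStep.

(** * The conjugacy *)

Section Construction.
Variables (R : realType) (X Y : topologicalType).
Variables (phi : R -> X -> X) (psi : R -> Y -> Y) (N : nat -> nat).
Variables (f g : nat -> R * R -> R * R) (p : nat -> X -> R * R) (q : nat -> Y -> R * R).
Variables (L : nat -> X -> R -> R) (M : Y -> R -> R) (D : nat -> R * R -> R).
Hypotheses (flX : is_flow phi) (flY : is_flow psi).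
Hypothesis pE : forall n x, p n x = f n (p n.+1 x).
Hypothesis p_cont : forall n, continuous (p n).
Hypothesis p_wedge : forall n x, wedge (N n) (p n x).
Hypothesis p_inj : forall x x', (forall n, p n x = p n x') -> x = x'.
Hypothesis qE : forall n y, q n y = g n (q n.+1 y).
Hypothesis q_cont : forall n, continuous (q n).
Hypothesis q_wedge : forall n y, wedge (N n) (q n y).
Hypothesis q_inj : forall y y', (forall n, q n y = q n y') -> y = y'.
Hypothesis q_onto : forall z : nat -> R * R,
  (forall i, wedge (N i) (z i) /\ g i (z i.+1) = z i) -> exists y, forall n, q n y = z n.
Hypothesis q_open : forall U : set Y, open U ->
  exists V : set {ptws nat -> (R * R)%type},
    open V /\ thread q @` U = V `&` range (thread q).
Hypothesis g_pos : forall n, positive_map (N n.+1) (N n) (g n).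
Hypothesis dX : forall n, displacement phi (N n) (p n) (L n).
Hypothesis dY : displacement psi (N 0%N) (q 0%N) M.
Hypothesis D_closed : forall n C, closed C -> closed (wedge (N n.+1) `&` D n @^-1` C).
Hypothesis D_lift : forall n (om : int -> nat), (forall j, (om j < N n.+1)%N) ->
  exists (lf lg : R -> R) (w : int -> nat),
    [/\ continuous lf, [/\ continuous lg, incr lg & forall v, exists s, lg s = v],
        forall s, f n (cp om s) = cp w (lf s), forall s, g n (cp om s) = cp w (lg s) &
        forall s, D n (cp om s) = lg s - lf s].

Let F n x t := L n x t + D n (p n.+1 (phi t x)).

Let phi0 x : phi 0 x = x. Proof. by case: flX => _ []. Qed.
Let phiD s t x : phi (s + t) x = phi s (phi t x). Proof. by case: flX => _ []. Qed.
Let psi0 y : psi 0 y = y. Proof. by case: flY => _ []. Qed.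
Let psiD s t y : psi (s + t) y = psi s (psi t y). Proof. by case: flY => _ []. Qed.

Lemma F_facts n x : [/\ incr (F n x), forall v, exists t, F n x t = v &
  forall t t', F n x t = L n x t' -> g n (p n.+1 (phi t x)) = p n (phi t' x)].
Proof. exact: (shifted_displacement (dX n) (dX n.+1) (pE n) (@D_lift n)). Qed.

Lemma F_continuous n t : continuous (fun x => F n x t).
Proof.
have cD := continuous_of_closed_wedge (@D_closed n) (@p_cont n.+1) (@p_wedge n.+1).
move=> x; apply: cvgD; first by case: (dX n) => _ _ h _ _; exact: h.
apply: (@continuous_comp _ _ _ (phi t) (D n \o p n.+1)); last exact: cD.
by apply: (flow_continuous flX (u := fun=> t)) => ?; [exact: cvg_cst|exact: cvg_id].
Qed.

(* [sh n x] is the time by which [x] has to be moved along its orbit so that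
   the level [n] coordinate of the moved point becomes the level [n]
   coordinate of the point of [Y] corresponding to [x]. *)
Definition Finv n x v : R := sval (cid ((let: And3 _ h _ := F_facts n x in h) v)).

Lemma FinvK n x v : F n x (Finv n x v) = v.
Proof. by rewrite /Finv; case: cid. Qed.

Fixpoint sh n : X -> R :=
  if n is n'.+1 then fun x => Finv n' x (L n' x (sh n' x)) else fun=> 0.

Lemma sh_continuous n : continuous (sh n).
Proof.
elim: n => [|n IH]; first by move=> x; exact: cvg_cst.
apply: (@implicit_continuous R X (F n)); first exact: F_continuous.
  by move=> x; case: (F_facts n x).
have -> : (fun x => F n x (sh n.+1 x)) = (fun x => L n x (sh n x)).
  by apply/funext => x; rewrite FinvK.
case: (dX n) => h1 _ h2 _ _.
by apply: (joint_continuous h2) => // x; case: (h1 x).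
Qed.

(** The point reached from [phi t x], written as a time on the orbit of [x]. In this form the
    recursion defining [sh] becomes [moved_eq], an equation on a single orbit. *)
Definition moved n x t : R := sh n (phi t x) + t.

Lemma moved_eq n x t : F n x (moved n.+1 x t) = L n x (moved n x t).
Proof.
case: (dX n) => _ DL _ _ _.
rewrite /moved /F !DL phiD -addrA; congr (_ + _).
exact: FinvK n (phi t x) (L n (phi t x) (sh n (phi t x))).
Qed.

Lemma moved_onto n x v : exists t, moved n x t = v.
Proof.
elim: n v => [|n IH] v; first by exists v; rewrite /moved add0r.
case: (dX n) => _ _ _ oL _; have [u hu] := oL x (F n x v).
have [t ht] := IH u; exists t.
have [iF _ _] := F_facts n x.
by apply: (incr_inj iF); rewrite moved_eq ht hu.
Qed.

Definition qX n x := p n (phi (sh n x) x).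

Lemma qX_moved n x t : qX n (phi t x) = p n (phi (moved n x t) x).
Proof. by rewrite /qX /moved phiD. Qed.

Lemma qX_continuous n : continuous (qX n).
Proof.
move=> x; apply: (@continuous_comp _ _ _ (fun x => phi (sh n x) x) (p n)); last exact: p_cont.
by apply: (flow_continuous flX) => ?; [exact: sh_continuous|exact: cvg_id].
Qed.

Lemma qX_onto x : exists y, forall n, q n y = qX n x.
Proof.
apply: q_onto => i; split; first exact: p_wedge.
by have [_ _ h] := F_facts i x; apply: h; exact: FinvK.
Qed.

Definition conjugacy x : Y := sval (cid (qX_onto x)).
Local Notation h := conjugacy.

Lemma q_conj n x : q n (h x) = qX n x.
Proof. by rewrite /conjugacy; case: cid. Qed.

Lemma conj_continuous : continuous h.
Proof.
apply/continuousP => U oU; have [V [oV eV]] := q_open oU.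
pose Q : X -> {ptws nat -> (R * R)%type} := fun x => thread q (h x).
have cQ : continuous Q.
  move=> x; apply/pointwise_cvgP => n.
  have e : qX n = (fun x' => Q x' n) by apply/funext => x'; rewrite -q_conj.
  by have := @qX_continuous n x; rewrite e; exact.
have -> : h @^-1` U = Q @^-1` V; last by move/continuousP: cQ; apply.
apply/seteqP; split=> x /= hx.
  have : (thread q @` U) (Q x) by exists (h x).
  by rewrite eV => -[].
have : (V `&` range (thread q)) (Q x) by split=> //; exists (h x).
rewrite -eV => -[y Uy e]; suff <- : y = h x by [].
by apply: q_inj => n; exact: (congr1 (@^~ n) e).
Qed.

Let L_incr n x : incr (L n x). Proof. by case: (dX n) => h _ _ _ _; case: (h x). Qed.
Let L_cont n x : continuous (L n x). Proof. by case: (dX n) => h _ _ _ _; case: (h x). Qed.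
Let L0 n x : L n x 0 = 0. Proof. exact: (displacement0 flX x (dX n)). Qed.
Let M0 y : M y 0 = 0. Proof. exact: (displacement0 flY y dY). Qed.
Let M_incr y : incr (M y). Proof. by case: dY => h _ _ _ _; case: (h y). Qed.

Lemma q_constant_orbit (gam : R -> Y) (S : set (R * R)) : continuous gam ->
  finite_set S -> (forall t, S (q 0%N (gam t))) -> forall t, gam t = gam 0.
Proof.
move=> cgam fS hS t; apply: q_inj => n.
have [S' [fS' hS']] : exists S', finite_set S' /\ forall t, S' (q n (gam t)).
  elim: n => [|n [S1 [fS1 hS1]]]; first by exists S.
  exists (\bigcup_(z in S1) (wedge (N n.+1) `&` g n @^-1` [set z])); split.
    by apply: bigcup_finite => // z _; exact: positive_map_fiber.
  by move=> u; exists (q n (gam u)).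
apply: (finite_range_constant _ fS' hS') => u.
by apply: (@continuous_comp _ _ _ gam (q n)); [exact: cgam|exact: q_cont].
Qed.

Lemma conj_orbit x : exists tau : R -> R,
  (forall t, M (h x) (tau t) = L 0%N x t) /\ forall t, h (phi t x) = psi (tau t) (h x).
Proof.
have [_ MD Mc Mo eM] := dY; have [_ _ _ _ eL] := dX 0%N.
have [u hu] := choice (fun t => Mo (h (phi t x)) (- L 0%N x t)).
have ch : continuous (fun t => h (phi t x)).
  move=> t; apply: (@continuous_comp _ _ _ (fun t => phi t x) h); last exact: conj_continuous.
  by apply: (flow_continuous flX (v := fun=> x)) => ?; [exact: cvg_id|exact: cvg_cst].
have cu : continuous u.
  apply: (@implicit_continuous R R (fun t v => M (h (phi t x)) v)).
  - move=> v t; apply: (@continuous_comp _ _ _ (fun t => h (phi t x)) (fun y => M y v)).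
      exact: ch.
    exact: Mc.
  - by move=> t; exact: M_incr.
  - have -> : (fun t => M (h (phi t x)) (u t)) = (fun t => - L 0%N x t).
      by apply/funext => t; rewrite hu.
    by move=> t; apply: cvgN; exact: L_cont.
have [c [w [wn ew]]] := eL x.
(* At level 0 the map [h] keeps coordinates, so flowing for time [u t] restores the phase [c]; each
   circle has only one point of that phase. *)
have const t : psi (u t) (h (phi t x)) = h x.
  have u0 : u 0 = 0.
    by apply: (incr_inj (@M_incr (h (phi 0 x)))); rewrite hu L0 M0 oppr0.
  have <- : psi (u 0) (h (phi 0 x)) = h x by rewrite u0 psi0 phi0.
  apply: (@q_constant_orbit (fun t => psi (u t) (h (phi t x)))
    (\bigcup_(k in `I_(N 0%N)) [set circle_pt k c])).
  - exact: (flow_continuous flY).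
  - by apply: bigcup_finite => [|k _]; [exact: finite_II|exact: finite_set1].
  - move=> v; have [c' [w' [wn' ew']]] := eM (h (phi v x)).
    rewrite ew' hu.
    have : q 0%N (h (phi v x)) = p 0%N (phi v x) by rewrite q_conj /qX phi0.
    rewrite -[X in q _ X = _]psi0 ew' M0 add0r ew => e.
    have [m em] := cp_phase e.
    have -> : - L 0%N x v + c' = c + (- m)%:~R by rewrite mulrNz; lra.
    exists (w' (Num.floor (c + (- m)%:~R))) => //=.
    by rewrite /cp circle_ptDz.
exists (fun t => - u t); split=> t.
  by have := MD (h (phi t x)) (- u t) (u t); rewrite addNr M0 hu const; lra.
by rewrite -(const t) -psiD addNr psi0.
Qed.

(** Matching equal increments at level 0 gives a time change [ka] from the orbit of [x] to that of
    [x'] that respects [h]. It commutes with the moves at every level, hence matches all coordinates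
    of the two orbits, and [ka 0 = 0]. *)
Lemma conj_injective : injective h.
Proof.
move=> x x' e.
have [tau [Mtau htau]] := conj_orbit x; have [tau' [Mtau' htau']] := conj_orbit x'.
have [_ _ _ oL _] := dX 0%N.
have [ka hka] := choice (fun t => oL x' (L 0%N x t)).
have tka t : tau' (ka t) = tau t.
  by apply: (incr_inj (@M_incr (h x))); rewrite Mtau [in LHS]e Mtau' hka.
have hk t : h (phi t x) = h (phi (ka t) x') by rewrite htau htau' tka e.
have cka : continuous ka.
  apply: (@implicit_continuous R R (fun _ v => L 0%N x' v)).
  - by move=> v t; exact: cvg_cst.
  - by move=> _; exact: L_incr.
  - have -> : (fun t => L 0%N x' (ka t)) = L 0%N x by apply/funext => t; rewrite hka.
    exact: L_cont.
have pk n t : p n (phi (moved n x t) x) = p n (phi (moved n x' (ka t)) x').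
  by rewrite -!qX_moved -!q_conj hk.
(* Since [moved n x] is onto, the induction hypothesis makes the level [n] coordinates of the two
   orbits agree under [ka], so their increments agree up to a constant. By [pk] the two instances of
   [moved_eq] have equal [D] terms. *)
have key n : forall t, moved n x' (ka t) = ka (moved n x t).
  elim: n => [|n IH] t; first by rewrite /moved !add0r.
  have [_ _ _ _ eL] := dX n.
  have [c [w [_ ew]]] := eL x; have [c' [w' [_ ew']]] := eL x'.
  have same v : p n (phi v x) = p n (phi (ka v) x').
    by have [s <-] := moved_onto n x v; rewrite pk IH.
  have H a b : a <= b -> L n x' (ka a) - L n x a = L n x' (ka b) - L n x b.
    move=> ab; suff : (L n x' (ka a) + c') - (L n x a + c) =
      (L n x' (ka b) + c') - (L n x b + c) by lra.
    apply: (@phase_unique R (fun v => L n x v + c) (fun v => L n x' (ka v) + c') w w').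
    - by move=> v; apply: cvgD; [exact: L_cont|exact: cvg_cst].
    - move=> v; apply: cvgD; last exact: cvg_cst.
      by apply: (@continuous_comp _ _ _ ka (L n x')); [exact: cka|exact: L_cont].
    - exact: ab.
    - by move=> v _ _; rewrite -ew -ew' same.
  have H' a b : L n x' (ka a) - L n x a = L n x' (ka b) - L n x b.
    by have [/H|/ltW/H] := leP a b.
  apply: (incr_inj (@L_incr n x')).
  have := moved_eq n x' (ka t); have := moved_eq n x t.
  rewrite IH /F (pk n.+1 t).
  by have := H' (moved n x t) (moved n.+1 x t); lra.
apply: p_inj => n.
have ka0 : ka 0 = 0 by apply: (incr_inj (@L_incr 0%N x')); rewrite hka !L0.
have [t ht] := moved_onto n x 0.
by have := pk n t; rewrite key ht ka0 !phi0.
Qed.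

Lemma conj_flow_equivalent : compact [set: X] -> minimal_flow psi -> X ->
  flow_equivalent phi psi.
Proof.
move=> cX minY xb.
have hY : hausdorff_space Y.
  move=> y y' cl; apply: q_inj => n.
  apply: (@norm_hausdorff _ (R * R)%type) => A B /q_cont nA /q_cont nB.
  by have [z [Az Bz]] := cl _ _ nA nB; exists (q n z).
have cl : closed (range h).
  apply: compact_closed => //; apply: continuous_compact => //.
  by apply: continuous_subspaceT; exact: conj_continuous.
have [_ _ _ oL _] := dX 0%N; have [_ _ _ oM _] := dY.
(* The image of [h] is closed and contains a whole orbit of [psi], which is dense by minimality. *)
have surj y : exists x, h x = y.
  have : closure (range (fun t => psi t (h xb))) y by rewrite minY.
  have sub : range (fun t => psi t (h xb)) `<=` range h.
    have [tau [Mtau htau]] := conj_orbit xb.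
    move=> _ [t _ <-]; have [s hs] := oL xb (M (h xb) t).
    exists (phi s xb) => //; rewrite htau; congr psi.
    by apply: (incr_inj (@M_incr (h xb))); rewrite Mtau.
  by move=> /(closure_subset sub); rewrite -(closure_id _).1 // => -[x _ <-]; exists x.
have [h' h'K] := choice surj.
have hK : cancel h h' by move=> x; apply: conj_injective; rewrite h'K.
exists h, h'; split=> //; split=> //; split; first exact: conj_continuous.
split; first exact: (compact_inverse_continuous cX hY conj_continuous hK h'K).
move=> x; have [tau [Mtau htau]] := conj_orbit x; exists tau; split; last split=> //.
  have [tau' htau'] := choice (fun v => oL x (M (h x) v)).
  exists tau' => t.
    by apply: (incr_inj (@L_incr 0%N x)); rewrite htau' Mtau.
  by apply: (incr_inj (@M_incr (h x))); rewrite Mtau htau'.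
by move=> s t st; rewrite -(incr_lt _ _ (@M_incr (h x))) !Mtau; exact: L_incr.
Qed.

End Construction.

Theorem theorem7p12 (R : realType) (X Y : topologicalType)
    (phi : R -> X -> X) (psi : R -> Y -> Y) (xb : X) (yb : Y)
    (N : nat -> nat) (f g : nat -> R * R -> R * R)
    (p : nat -> X -> R * R) (q : nat -> Y -> R * R) :
  flow_space phi -> minimal_flow phi -> aperiodic_flow phi ->
  flow_space psi -> minimal_flow psi -> aperiodic_flow psi ->
  expansion phi xb N f p -> expansion psi yb N g q ->
  (forall i, exists a : R -> R * R, loop (N i) a /\
     forall gam : R -> R * R, loop (N i.+1) gam ->
       loop_homotopic (N i) (g i \o gam) (pcat (path_rev a) (pcat (f i \o gam) a))) ->
  flow_equivalent phi psi.
Proof.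
move=> [cX [_ [_ [flX _]]]] _ _ [cY [_ [_ [flY _]]]] minY _.
move=> [fpos pproj _ pcomp [_ pinj _ _]] [gpos qproj _ qcomp [_ qinj qrange qopen]] conjfg.
have [L dX] := choice (fun n => projection_displacement cX flX (pproj n)).
have [M dY] := projection_displacement cY flY (qproj 0%N).
have [D HD] := choice (fun n => conj_displacement (fpos n) (gpos n) (conjfg n)).
apply: (@conj_flow_equivalent R X Y phi psi N f g p q L M D) => //.
- by move=> n x; rewrite (pcomp n n.+1) ?leqnSn // subSnn /= addn0.
- by move=> n; case: (pproj n).
- by move=> n x; case: (pproj n) => _ <- _; exists x.
- by move=> x x' e; apply: pinj; apply/funext => n; exact: e.
- by move=> n y; rewrite (qcomp n n.+1) ?leqnSn // subSnn /= addn0.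
- by move=> n; case: (qproj n).
- by move=> n y; case: (qproj n) => _ <- _; exists y.
- by move=> y y' e; apply: qinj; apply/funext => n; exact: e.
- move=> z hz; have : invlim N g z by [].
  by rewrite -qrange => -[y _ <-]; exists y.
- by move=> n C cC; case: (HD n) => h _; exact: h.
- by move=> n om omm; case: (HD n) => _ h; exact: h.
Qed.
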